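(* Let $0<\gamma<1$. Suppose both $f_1$ and $f_2$ are locally Lipschitz on $(\alpha,\beta)$ and satisfy $f_1(u)\ge f_2(u)$ for any $u\in(\alpha,\beta)$. Assume that one of them is non-decreasing. Let $u_1$ and $u_2$ be the solutions of $D_c^{\gamma}u=f_1(u)$ and $D_c^{\gamma}u=f_2(u)$ on the intervals $(0,T_b^1)$ and $(0,T_b^2)$ with initial values $u_1(0)$ and $u_2(0)$ respectively. If in addition $\alpha<u_2(0)\le u_1(0)<\beta$, then $$u_1(t)\ge u_2(t),\qquad\forall t\in(0,\min(T_b^1,T_b^2)).$$
   Context: Fix $\gamma\in(0,1)$. A function $u\in L^1_{loc}(0,T)$ has right limit $u(0+)=u_0$ at $t=0$ if $\lim_{t\to0+}\frac1t\int_0^t|u(s)-u_0|\,ds=0$. For such $u$, the (generalized) Caputo derivative is the distribution on $(-\infty,T)$ supported in $[0,T)$ given by $D_c^{\gamma}u=g_{-\gamma}*\big((u-u(0+))\theta(t)\big)$, where $\theta$ is the Heaviside function and $g_{-\gamma}=\frac{1}{\Gamma(1-\gamma)}D\big(\theta(t)t^{-\gamma}\big)$ with $D$ the distributional derivative. A strong solution of $D_c^\gamma u=f(u)$, $u(0)=u_0$, is such a $u$ with $u(0+)=u_0$, $D_c^{\gamma}u\in L^1(0,T)$, satisfying the equation almost everywhere. It is known that for continuous $u$ the problem is equivalent to the Volterra equation $u(t)=u_0+\frac{1}{\Gamma(\gamma)}\int_0^t(t-s)^{\gamma-1}f(u(s))\,ds$. If $f$ is locally Lipschitz on $(\alpha,\beta)$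 and $u_0\in(\alpha,\beta)$, there is a unique continuous strong solution (with values in $(\alpha,\beta)$) on a maximal interval $[0,T_b)$, $T_b\in(0,\infty]$, and if $T_b<\infty$ then $\liminf_{t\to T_b^-}u(t)=\alpha$ or $\limsup_{t\to T_b^-}u(t)=\beta$. The solutions $u_i$ and times $T_b^i$ refer to this. *)

(* Defs.v *)
From HB Require Import structures.
From mathcomp Require Import all_boot all_order all_algebra.
From mathcomp Require Import all_classical all_reals all_analysis.
Set Implicit Arguments.
Unset Strict Implicit.
Unset Printing Implicit Defensive.
Import Order.TTheory GRing.Theory Num.Theory.
Import numFieldNormedType.Exports.
Local Open Scope classical_set_scope.
Local Open Scope ring_scope.

Section Caputo.
Variable R : realType.
Local Notation mu := (@lebesgue_measure R).

Definition Gamma (x : R) : R :=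
  \int[mu]_(t in `]0, +oo[) (t `^ (x - 1) * expR (- t)).

(* The end points are extended reals: infinite end points are allowed. *)
Definition open_interval (a b : \bar R) : set R :=
  [set x | (a < x%:E)%E /\ (x%:E < b)%E].

Definition locally_lipschitz (f : R -> R) (I : set R) : Prop :=
  forall x, I x -> exists2 U, nbhs x U & [lipschitz f y | y in U `&` I].

Definition nondecreasing_on (f : R -> R) (I : set R) : Prop :=
  forall x y, I x -> I y -> x <= y -> f x <= f y.

(* The elements of C_c^oo((-oo, T)), extended by 0 to the whole line. *)
Definition test_function (T : R) (phi : R -> R) : Prop :=
  [/\ forall n x, derivable (derive1n n phi) x 1,
      compact (closure [set x | phi x != 0]) &
      closure [set x | phi x != 0] `<=` `]-oo, T[].

(* A distribution is represented by its action on test functions. *)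
Definition functional := (R -> R) -> R.

Definition regular_dist (h : R -> R) : functional :=
  fun phi => \int[mu]_t (h t * phi t).

Definition distD (F : functional) : functional := fun phi => - F (derive1 phi).

Definition heaviside (t : R) : R := if 0 <= t then 1 else 0.

Definition g_neg (gamma : R) : functional := fun phi =>
  (Gamma (1 - gamma))^-1
    * distD (regular_dist (fun t => heaviside t * t `^ (- gamma))) phi.

(* <G * v, phi> = <v(t), <G(s), phi(s + t)>> for a function v on (-oo, T). For
   G supported in [0, +oo), v supported in [0, T) and phi supported in
   (-oo, T), the inner pairing vanishes for t close to T, so only the local
   integrability of v on [0, T) matters. *)
Definition conv_dist (T : R) (G : functional) (v : R -> R) : functional :=
  fun phi => \int[mu]_(t in `]-oo, T[) (v t * G (fun s => phi (s + t))).

(* The Caputo derivative, as a distribution on (-oo, T), of a function u on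
   (0, T) whose right limit u(0+) is u0. *)
Definition caputo (gamma T u0 : R) (u : R -> R) : functional :=
  conv_dist T (g_neg gamma) (fun t => (u t - u0) * heaviside t).

Definition right_limit0 (u : R -> R) (u0 : R) : Prop :=
  ((t^-1)%:E * \int[mu]_(s in `]0%R, t[) `|u s - u0|%:E)%E
    @[t --> (0 : R)^'+] --> 0%E.

(* The function h is the distribution D_c^gamma u, seen as an element of
   L^1(0, T); being an identity on (-oo, T), the second clause of the
   existential also excludes any singular part at 0. *)
Definition strong_solution (gamma : R) (f : R -> R) (u0 T : R) (u : R -> R) :
    Prop :=
  [/\ locally_integrable `]0, T[ u,
      right_limit0 u u0 &
      exists h : R -> R,
        [/\ mu.-integrable `]0, T[ (EFin \o h),
            forall phi, test_function T phi ->
              caputo gamma T u0 u phi = \int[mu]_(t in `]0, T[) (h t * phi t) &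
            {ae mu, forall t, t \in `]0, T[ -> h t = f (u t)}]].

Definition half_open (Tb : \bar R) : set R :=
  [set t | 0 <= t /\ (t%:E < Tb)%E].

(* Continuous strong solution on [0, Tb), with values in (alpha, beta) and
   initial value u 0. As f(u) need not be integrable up to Tb (blow-up, or
   Tb = +oo), being a strong solution is required on (0, T) for every T < Tb. *)
Definition continuous_strong_solution (gamma : R) (f : R -> R)
    (alpha beta : \bar R) (Tb : \bar R) (u : R -> R) : Prop :=
  [/\ (0 < Tb)%E,
      {within half_open Tb, continuous u},
      forall t, half_open Tb t -> open_interval alpha beta (u t) &
      forall T : R, 0 < T -> (T%:E < Tb)%E -> strong_solution gamma f (u 0) T u].

(* [0, Tb) is the maximal interval of existence: u has no proper extension. *)
Definition maximal_solution (gamma : R) (f : R -> R)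
    (alpha beta : \bar R) (Tb : \bar R) (u : R -> R) : Prop :=
  continuous_strong_solution gamma f alpha beta Tb u /\
  forall (Tb' : \bar R) (v : R -> R),
    continuous_strong_solution gamma f alpha beta Tb' v ->
    (forall t, half_open Tb t -> v t = u t) -> (Tb' <= Tb)%E.

End Caputo.

(* Main.v *)
Require Import Defs.
From HB Require Import structures.
From mathcomp Require Import all_boot all_order all_algebra.
From mathcomp Require Import all_classical all_reals all_analysis.
From mathcomp Require Import measurable_realfun ring lra.
Set Implicit Arguments.
Unset Strict Implicit.
Unset Printing Implicit Defensive.
Import Order.TTheory GRing.Theory Num.Theory.
Import numFieldNormedType.Exports.
Local Open Scope classical_set_scope.
Local Open Scope ring_scope.

(** Why the theorem holds.  Fix T below both existence times.  On [0, T] each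
solution satisfies a Volterra equation
    K (u x - u 0) = int_0^x (x - s)^(gamma - 1) f (u s) ds,   K > 0,
whose kernel is positive.  Let w = u1 - u2 and subtract the two equations.
If f is the nondecreasing one of f1 and f2, then f2 y - f1 z <= f y - f z for
all y and z, so that f1 (u1 s) - f2 (u2 s) is nonnegative as soon as w s >= 0,
and is at least - L w^- s while u1 s and u2 s stay in a set where f is
L-Lipschitz.  Suppose that w takes a negative value, and let a be the infimum
of the times where it does.  Then w a = 0, the past of a contributes with the
favourable sign, and on [a, a + d] the kernel has mass at most d^gamma / gamma.
For small d, the maximum m of w^- on [a, a + d] therefore satisfies m <= m / 2,
hence m = 0, against the choice of a.  This is volterra_comparison.  The
Lipschitz bound is needed only near the common value u1 a = u2 a, and the
Volterra equations only almost everywhere, because w is continuous.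

Most of the work is to extract the Volterra equation from the distributional
one.  Let W be u - u 0 divided by Gamma (1 - gamma), let H be f o u, both
restricted to [0, T[, and let * be convolution.  For a bump eta with support in
]0, T[, the function x |-> int_x^(x + c) eta is a test function as soon as the
support of eta lies in ]0, c[; on [0, +oo[ it is the primitive of - eta that
vanishes at +oo, while its increasing part lies on the negative half-line,
which the Caputo derivative does not see.  Tonelli's theorem then turns the
weak equation into
    int eta (s^(- gamma) * W) = int eta (1 * H),
and letting eta increase to indicators of intervals gives Abel's equation
s^(- gamma) * W = 1 * H almost everywhere on ]0, T[ (ae_eq_of_pairing).  Since
s^(gamma - 1) * s^(- gamma) is a constant B (convol_rlker), convolving Abel's
equation with s^(gamma - 1) gives 1 * (B W) = 1 * (s^(gamma - 1) * H), and
differentiating gives the Volterra equation (abel_inversion).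

Convolutions are taken between nonnegative functions with extended real values,
so that associativity and commutativity hold without integrability conditions.
A signed function enters through its positive and negative parts, each moved to
the side of the equation where it carries a plus sign. *)

(** * Convolution of nonnegative functions *)

Section Conv.
Variable R : realType.
Local Notation mu := (@lebesgue_measure R).
Local Open Scope ereal_scope.

(** Lebesgue measure is determined by its values on half-open intervals, and an
increasing affine map multiplies their lengths by its slope. *)
Lemma ge0_integral_affine (c d : R) (g : R -> \bar R) : (0 < c)%R ->
  measurable_fun [set: R] g -> (forall x, 0 <= g x) ->
  \int[mu]_x g x = c%:E * \int[mu]_x g (c * x + d)%R.
Proof.
move=> c0 mg g0.
pose F : R -> measurableTypeR R := fun x => (c * x + d)%R.
have mF : measurable_fun [set: R] F.
  by apply: measurable_funD => //; exact: measurable_funM.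
pose nu0 : {measure set (measurableTypeR R) -> \bar R} :=
  measure_function_pushforward__canonical__measure_function_Measure mu mF.
pose nu : {measure set (measurableTypeR R) -> \bar R} :=
  mscale (NngNum (ltW c0)) nu0.
have nuE : forall A, measurable A -> mu A = nu A.
  apply: lebesgue_measure_unique => _ [[a b]] _ <-.
  rewrite /nu /= /mscale /= /nu0 /= /pushforward.
  have -> : F @^-1` `]a, b]%classic =
      `]((a - d) / c)%R, ((b - d) / c)%R]%classic.
    apply/seteqP; split => x /=; rewrite !in_itv/= /F /=.
      by rewrite ltr_pdivrMr// ler_pdivlMr// ltrBlDr lerBrDr ![(x * c)%R]mulrC.
    by rewrite ltr_pdivrMr// ler_pdivlMr// ltrBlDr lerBrDr ![(x * c)%R]mulrC.
  rewrite !lebesgue_measure_itv/= !lte_fin ltr_pM2r ?invr_gt0// ltrD2r.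
  case: ifPn => _; last by rewrite mule0.
  by rewrite -!EFinD -EFinM; congr EFin; field; rewrite gt_eqF.
have -> : \int[mu]_x g x = \int[nu]_x g x.
  by apply: eq_measure_integral => A mA _; exact: nuE.
rewrite /nu ge0_integral_mscale//.
congr (_ * _).
by rewrite ge0_integral_pushforward.
Qed.

Lemma ge0_integral_opp (g : R -> \bar R) :
  measurable_fun [set: R] g -> (forall x, 0 <= g x) ->
  \int[mu]_x g (- x)%R = \int[mu]_x g x.
Proof.
move=> mg g0.
rewrite -(@ge0_integral_pushforward _ _ (measurableTypeR R) (measurableTypeR R)
  R -%R _ mu setT g)//.
by apply: eq_measure_integral => A mA _; exact: lebesgue_measureN.
Qed.

Lemma ge0_integral_reflect (t : R) (g : R -> \bar R) :
  measurable_fun [set: R] g -> (forall x, 0 <= g x) ->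
  \int[mu]_x g (t - x)%R = \int[mu]_x g x.
Proof.
move=> mg g0; rewrite [RHS](@ge0_integral_affine 1 t)// mul1e.
rewrite -[RHS]ge0_integral_opp//.
- by apply: eq_integral => x _; congr g; ring.
- by apply: measurableT_comp => //; apply: measurable_funD => //;
  exact: measurable_funM.
Qed.

Definition convol (a b : R -> \bar R) : R -> \bar R :=
  fun t => \int[mu]_s (a (t - s)%R * b s).

Section theory.
Variables a b c : R -> \bar R.
Hypotheses (ma : measurable_fun [set: R] a) (mb : measurable_fun [set: R] b)
  (mc : measurable_fun [set: R] c).
Hypotheses (a0 : forall x, 0 <= a x) (b0 : forall x, 0 <= b x)
  (c0 : forall x, 0 <= c x).

Lemma convol_ge0 t : 0 <= convol a b t.
Proof. by apply: integral_ge0 => s _; exact: mule_ge0. Qed.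

Lemma measurable_convol : measurable_fun [set: R] (convol a b).
Proof.
apply: (@measurable_fun_fubini_tonelli_F _ _ _ _ _ mu
  (fun p : measurableTypeR R * measurableTypeR R =>
    a (p.1 - p.2)%R * b p.2)) => /=.
  apply: emeasurable_funM; apply: measurableT_comp => //.
  exact: measurable_funB.
by move=> x; exact: mule_ge0.
Qed.

Lemma convolC t : convol a b t = convol b a t.
Proof.
rewrite /convol -[RHS](@ge0_integral_reflect t).
- by apply: eq_integral => x _; rewrite muleC subKr.
- by apply: emeasurable_funM => //; apply: measurableT_comp => //;
  exact: measurable_funB.
- by move=> x; exact: mule_ge0.
Qed.

(** Exchange the integrals by Tonelli's theorem, then translate the inner
variable. *)
Lemma convolA t : convol a (convol b c) t = convol (convol a b) c t.
Proof.
rewrite /convol.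
transitivity (\int[mu]_s \int[mu]_r (a (t - s)%R * (b (s - r)%R * c r))).
  apply: eq_integral => s _; rewrite ge0_integralZl//.
  - apply: emeasurable_funM => //; apply: measurableT_comp => //;
    exact: measurable_funB.
  - by move=> r _; exact: mule_ge0.
rewrite (fubini_tonelli (fun p : measurableTypeR R * measurableTypeR R =>
  a (t - p.1)%R * (b (p.1 - p.2)%R * c p.2)))/=; last 2 first.
- apply: emeasurable_funM; last apply: emeasurable_funM;
  apply: measurableT_comp => //; exact: measurable_funB.
- by move=> p; rewrite !mule_ge0.
apply: eq_integral => r _.
rewrite -ge0_integralZr//; last 2 first.
- by apply: emeasurable_funM => //; apply: measurableT_comp => //;
  exact: measurable_funB.
- by move=> x _; exact: mule_ge0.
rewrite (@ge0_integral_affine 1 r) ?ltr01//; first last.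
- by move=> x; rewrite !mule_ge0.
- apply: emeasurable_funM; last apply: emeasurable_funM => //;
  apply: measurableT_comp => //; exact: measurable_funB.
rewrite mul1e; apply: eq_integral => s _; rewrite muleA.
by congr (a _ * b _ * _); lra.
Qed.

(** The transpose of the convolution with [a]: it moves the integral operator
from the test function [eta] to the unknown [b]. *)
Lemma convol_adj (eta : R -> \bar R) :
  measurable_fun [set: R] eta -> (forall x, 0 <= eta x) ->
  \int[mu]_t (b t * \int[mu]_r (a (r - t)%R * eta r)) =
  \int[mu]_r (eta r * convol a b r).
Proof.
move=> me e0.
transitivity (\int[mu]_t \int[mu]_r (b t * (a (r - t)%R * eta r))).
  apply: eq_integral => t _; rewrite ge0_integralZl//.
  - by apply: emeasurable_funM => //; apply: measurableT_comp => //;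
    exact: measurable_funB.
  - by move=> r _; exact: mule_ge0.
rewrite (fubini_tonelli (fun p : measurableTypeR R * measurableTypeR R =>
  b p.1 * (a (p.2 - p.1)%R * eta p.2)))/=; last 2 first.
- apply: emeasurable_funM; last apply: emeasurable_funM;
  apply: measurableT_comp => //; exact: measurable_funB.
- by move=> p; rewrite !mule_ge0.
apply: eq_integral => r _; rewrite /convol -ge0_integralZl//.
- by apply: eq_integral => s _; rewrite muleA muleC (muleC (b s)).
- by apply: emeasurable_funM => //; apply: measurableT_comp => //;
  exact: measurable_funB.
- by move=> x _; exact: mule_ge0.
Qed.

Lemma convolDr t :
  convol a (fun x => b x + c x) t = convol a b t + convol a c t.
Proof.
rewrite /convol; under eq_integral do rewrite ge0_muleDr//.
rewrite ge0_integralD//.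
- by move=> x _; exact: mule_ge0.
- by apply: emeasurable_funM => //; apply: measurableT_comp => //;
  exact: measurable_funB.
- by move=> x _; exact: mule_ge0.
- by apply: emeasurable_funM => //; apply: measurableT_comp => //;
  exact: measurable_funB.
Qed.

Lemma convolZr (k : R) t : (0 <= k)%R ->
  convol a (fun x => k%:E * b x) t = k%:E * convol a b t.
Proof.
move=> k0; rewrite /convol; under eq_integral do rewrite muleCA.
rewrite ge0_integralZl//.
- by apply: emeasurable_funM => //; apply: measurableT_comp => //;
  exact: measurable_funB.
- by move=> x _; exact: mule_ge0.
Qed.

Lemma convolZl (k : R) t : (0 <= k)%R ->
  convol (fun x => k%:E * a x) b t = k%:E * convol a b t.
Proof.
move=> k0; rewrite /convol; under eq_integral do rewrite -muleA.
rewrite ge0_integralZl//.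
- by apply: emeasurable_funM => //; apply: measurableT_comp => //;
  exact: measurable_funB.
- by move=> x _; exact: mule_ge0.
Qed.
End theory.
End Conv.

(** * Riemann-Liouville kernels and the gamma and beta integrals *)

Section Kernel.
Variable R : realType.
Local Notation mu := (@lebesgue_measure R).

Implicit Types (a b d s t x : R).

(** The Riemann-Liouville kernel of order [a], without its factor 1 / Gamma a.
The strict cut-off makes [rlker 1] the indicator of ]0, +oo[ and lets the
convolution identities hold at every point, 0 included. *)
Definition rlker (a s : R) : R := if 0 < s then s `^ (a - 1) else 0.

Lemma rlker_ge0 a s : 0 <= rlker a s.
Proof. by rewrite /rlker; case: ifP => // _; exact: powR_ge0. Qed.

Lemma measurable_rlker a : measurable_fun [set: R] (rlker a).
Proof.
apply: measurable_fun_if => //.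
- exact: measurable_fun_ltr.
- by apply: measurable_funTS; exact: measurable_powR.
Qed.

Lemma measurable_rlkerE a : measurable_fun [set: R] (EFin \o rlker a).
Proof. by apply/measurable_EFinP; exact: measurable_rlker. Qed.

Lemma measurable_rlkerB a t :
  measurable_fun [set: R] (fun s => (rlker a (t - s))%:E).
Proof.
apply/measurable_EFinP; apply: measurableT_comp; first exact: measurable_rlker.
exact: measurable_funB.
Qed.

Lemma rlkerE0 a s : s <= 0 -> rlker a s = 0.
Proof. by rewrite leNgt /rlker => /negbTE ->. Qed.

Lemma rlker1 s : 0 < s -> rlker 1 s = 1.
Proof. by rewrite /rlker => ->; rewrite subrr powRr0. Qed.

Lemma rlkerM a t s : 0 < t -> rlker a (t * s) = t `^ (a - 1) * rlker a s.
Proof.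
move=> t0; rewrite /rlker pmulr_rgt0//; case: ifP => s0; last by rewrite mulr0.
by rewrite powRM// ltW.
Qed.

Lemma rlker_ge1 a s : a <= 1 -> 0 < s -> s <= 1 -> 1 <= rlker a s.
Proof.
move=> a1 s0 s1; rewrite /rlker s0 -[leLHS](powRr0 s).
by rewrite ger_powR ?s0// subr_le0.
Qed.

Lemma rlker_le2 a s : 0 <= a -> 2^-1 <= s -> s <= 1 -> rlker a s <= 2.
Proof.
move=> a0 s0 s1.
have s0' : 0 < s by apply: lt_le_trans s0; rewrite invr_gt0.
rewrite /rlker s0'; apply: (@le_trans _ _ (s `^ (- 1))).
  by apply: ger_powR; [rewrite s0'|lra].
by rewrite powR_inv1 ?(ltW s0')// -[leRHS]invrK lef_pV2 ?posrE ?invr_gt0.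
Qed.

(** The kernel may be unbounded at 0, so the fundamental theorem of calculus is
applied on [d / (n + 1), d], and n tends to infinity. *)
Lemma integral_rlker_le a d : 0 < a -> 0 < d ->
  (\int[mu]_(s in `]0%R, d]) (rlker a s)%:E <= (d `^ a / a)%:E)%E.
Proof.
move=> a0 d0.
pose F n : set R := `[(d / n.+1%:R), d]%classic.
have -> : `]0, d]%classic = \bigcup_n F n.
  apply/seteqP; split => [s /=|s [n _]]; rewrite /F /= !in_itv/=; last first.
    by move=> /andP[ns ->]; rewrite (lt_le_trans _ ns)// divr_gt0.
  move=> /andP[s0 sd]; exists (Num.truncn (d / s)) => //=; rewrite in_itv/=
    sd andbT.
  rewrite ler_pdivrMr// mulrC -ler_pdivrMr//.
  exact/ltW/truncnS_gt.
have Fpos n s : F n s -> 0 < s.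
  by rewrite /F /= in_itv/= => /andP[+ _]; apply: lt_le_trans; rewrite divr_gt0.
have cvgF : (\int[mu]_(x in F i) (rlker a x)%:E @[i --> \oo] -->
    \int[mu]_(x in \bigcup_i F i) (rlker a x)%:E)%E.
  apply: ge0_nondecreasing_set_cvg_integral => //.
  - apply/nondecreasing_seqP => n; apply/subsetPset => s; rewrite /F /=
    !in_itv/=.
    move=> /andP[ns ->]; rewrite andbT; apply: le_trans ns.
    by rewrite ler_pM2l// lef_pV2 ?posrE// ler_nat.
  - by move=> n; exact: measurable_itv.
  - by move=> n; apply: measurable_funTS; exact: measurable_rlkerE.
  - by move=> n x _; rewrite lee_fin rlker_ge0.
rewrite -(cvg_lim _ cvgF)//.
apply: lime_le; first by apply/cvg_ex; eexists; exact: cvgF.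
apply: nearW => n.
have [->|n0] := eqVneq n 0%N.
  rewrite /F divr1 set_itv1 integral_set1 lee_fin divr_ge0 ?powR_ge0// ltW//.
have Fn : d / n.+1%:R < d.
  by rewrite gtr_pMr// invf_lt1// ltr1n ltnS lt0n.
have dn0 : 0 < d / n.+1%:R by rewrite divr_gt0.
pose G x := (a^-1 * x `^ a).
have dG x : 0 < x -> is_derive x 1 G (x `^ (a - 1)).
  move=> x0.
  have -> : x `^ (a - 1) = a^-1 *: (a * x `^ (a - 1)).
    by rewrite /GRing.scale/= mulKf// gt_eqF.
  exact: (@is_deriveZ _ _ _ (fun y : R => y `^ a : R^o) _ _ _ _
    (is_derive1_powR a x0)).
under eq_integral.
  move=> x /set_mem /Fpos x0; rewrite /rlker x0; over.
rewrite /F (@continuous_FTC2 _ _ G)//.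
- rewrite -EFinB lee_fin /G mulrC lerBlDr mulrC lerDl.
  by rewrite mulr_ge0 ?invr_ge0 ?powR_ge0// ltW.
- apply: derivable_within_continuous => x; rewrite in_itv/= => /andP[dx _].
  have x0 : 0 < x by exact: lt_le_trans dx.
  by apply: derivable_powR; rewrite in_itv/= x0.
- have cG x : 0 < x -> {for x, continuous G}.
    move=> x0; apply: differentiable_continuous; apply/derivable1_diffP.
    by have [] := dG _ x0.
  split.
  + move=> x; rewrite in_itv/= => /andP[dx _].
    by have [] := dG _ (lt_trans dn0 dx).
  + by apply: cvg_at_right_filter; exact: cG.
  + by apply: cvg_at_left_filter; exact: cG.
- move=> x; rewrite in_itv/= => /andP[dx _].
  by rewrite derive1E; have [_ ->] := dG _ (lt_trans dn0 dx).
Qed.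

Local Open Scope ereal_scope.

Definition beta a b : \bar R := convol (EFin \o rlker a) (EFin \o rlker b) 1.

(** The substitution s = t x reduces the convolution at t to the one at 1.  For
a + b = 1 the result is constant on ]0, +oo[, which is what inverts the Abel
equation. *)
Lemma convol_rlker a b t :
  convol (EFin \o rlker a) (EFin \o rlker b) t =
  beta a b * (rlker (a + b) t)%:E.
Proof.
have [t0|t0] := leP t 0%R.
  rewrite rlkerE0// mule0 /convol; apply: integral0_eq => s _ /=.
  have [s0|s0] := leP s 0%R; first by rewrite (rlkerE0 _ s0) mule0.
  by rewrite rlkerE0 ?mul0e// subr_le0 (le_trans t0)// ltW.
rewrite /convol (@ge0_integral_affine _ t 0)//; first last.
- by move=> x; rewrite mule_ge0// lee_fin rlker_ge0.
- apply: emeasurable_funM; last exact: measurable_rlkerE.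
  exact: measurable_rlkerB.
under eq_integral => x _.
  rewrite /= addr0 (_ : t - t * x = t * (1 - x))%R;
    last by rewrite mulrBr mulr1.
  rewrite 2?rlkerM// -EFinM mulrACA EFinM; over.
rewrite ge0_integralZl//; last 3 first.
- apply/measurable_EFinP/measurable_funM; last exact: measurable_rlker.
  by apply: (measurableT_comp (measurable_rlker a)); exact: measurable_funB.
- by move=> x _; rewrite lee_fin mulr_ge0 ?rlker_ge0.
- by rewrite lee_fin mulr_ge0 ?powR_ge0.
rewrite muleA -EFinM muleC /beta /convol; congr (_ * _%:E).
rewrite /rlker t0 -powRD; last by apply/implyP => _; rewrite gt_eqF.
rewrite -[X in (X * _)%R](powRr1 (ltW t0)) -powRD; last by apply/implyP => _;
  rewrite gt_eqF.
by congr (_ `^ _)%R; ring.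
Qed.

(** Both kernels are at least 1 on ]0, 1[. *)
Lemma beta_ge1 a b : (a <= 1)%R -> (b <= 1)%R -> 1 <= beta a b.
Proof.
move=> a1 b1; rewrite /beta /convol.
have m : measurable_fun [set: R] (fun s => (EFin \o rlker a) (1 - s)%R *
  (EFin \o rlker b) s).
  apply: emeasurable_funM; last exact: measurable_rlkerE.
  exact: measurable_rlkerB.
have -> : 1 = \int[mu]_(s in `]0%R, 1%R[) (cst 1 s).
  by rewrite integral_cst//= lebesgue_measure_itv/= lte_fin ltr01 sube0 mul1e.
apply: (@le_trans _ _ (\int[mu]_(s in `]0%R, 1%R[)
  ((EFin \o rlker a) (1 - s)%R * (EFin \o rlker b) s))).
  apply: ge0_le_integral => //.
  - exact: measurable_funTS.
  - move=> s /=; rewrite in_itv/= => /andP[s0 s1].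
    rewrite -EFinM lee_fin mulr_ege1// rlker_ge1//; lra.
apply: ge0_subset_integral => //.
by move=> s _; rewrite mule_ge0// lee_fin rlker_ge0.
Qed.

Lemma integral_rlker01_lty a : (0 < a)%R ->
  \int[mu]_s ((rlker a \_ `]0%R, 1%R]) s)%:E < +oo.
Proof.
move=> a0.
have -> : \int[mu]_s ((rlker a \_ `]0%R, 1%R]) s)%:E =
    \int[mu]_(s in `]0%R, 1%R]) (rlker a s)%:E.
  by rewrite [RHS]integral_mkcond; apply: eq_integral => s _; rewrite !patchE;
    case: ifP.
apply: (le_lt_trans (integral_rlker_le a0 ltr01)).
exact: ltry.
Qed.

Lemma measurable_rlker01 a :
  measurable_fun [set: R] (fun s => ((rlker a \_ `]0%R, 1%R]) s)%:E).
Proof.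
apply/measurable_EFinP/(measurable_restrictT _ _).1 => //.
by apply: measurable_funTS; exact: measurable_rlker.
Qed.

Lemma rlker01_ge0 a s : (0 <= (rlker a \_ `]0, 1]) s)%R.
Proof. by apply: restrict_ge0 => x _; exact: rlker_ge0. Qed.

(** At each point of ]0, 1[ one of the two factors is evaluated beyond 1/2,
where it is at most 2: the product is at most twice the sum of the factors. *)
Lemma beta_lty a b : (0 < a)%R -> (0 < b)%R -> beta a b < +oo.
Proof.
move=> a0 b0.
pose J a s := ((rlker a \_ `]0%R, 1%R]) s)%:E.
have J0 c s : 0 <= J c s by rewrite lee_fin rlker01_ge0.
have JE c s : (0 < s)%R -> (s <= 1)%R -> J c s = (rlker c s)%:E.
  by move=> s0 s1; rewrite /J patchE ifT// inE/= in_itv/= s0.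
have mJ1 : measurable_fun [set: R] (fun s => J a (1 - s)%R).
  by apply: (measurableT_comp (measurable_rlker01 a)); exact: measurable_funB.
have mJ2 := measurable_rlker01 b.
apply: (@le_lt_trans _ _ (\int[mu]_s (2%:E * (J a (1 - s)%R + J b s)))).
  apply: ge0_le_integral => //.
  - by move=> s _; rewrite mule_ge0// lee_fin rlker_ge0.
  - apply: emeasurable_funM; last exact: measurable_rlkerE.
    exact: measurable_rlkerB.
  - by apply: emeasurable_funM => //; exact: emeasurable_funD.
  move=> s _ /=.
  have [s0|s0] := leP s 0%R.
    by rewrite (rlkerE0 _ s0) mule0 mule_ge0// adde_ge0.
  have [s1|s1] := leP 1%R s.
    by rewrite (rlkerE0 a) ?subr_le0// mul0e mule_ge0// adde_ge0.
  have s1' : (0 < 1 - s)%R by rewrite subr_gt0.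
  have s1'' : (1 - s <= 1)%R by lra.
  rewrite (JE a)// (JE b)// ?(ltW s1)//.
  rewrite -EFinD -!EFinM lee_fin mulrDr.
  have [s2|s2] := leP s (2^-1)%R.
    rewrite -[leLHS]add0r lerD//; first by rewrite mulr_ge0// rlker_ge0.
    rewrite ler_wpM2r// ?rlker_ge0// rlker_le2// ?(ltW a0)//; lra.
  rewrite -[leLHS]addr0 lerD//; last by rewrite mulr_ge0// rlker_ge0.
  by rewrite mulrC ler_wpM2r// ?rlker_ge0// rlker_le2// ?(ltW b0) ?(ltW s2)
    ?(ltW s1).
rewrite ge0_integralZl//; last 2 first.
- exact: emeasurable_funD.
- by move=> s _; rewrite adde_ge0.
rewrite ge0_integralD// (ge0_integral_reflect 1 (measurable_rlker01 a));
  last exact: J0.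
by rewrite lte_mul_pinfty// lte_add_pinfty// integral_rlker01_lty.
Qed.

(** The real-valued integral of a function with infinite integral is 0, so that
positivity includes the convergence of the integral: [rlker a] dominates near 0
and the exponential density near +oo. *)
Lemma Gamma_gt0 a : (0 < a <= 1)%R -> (0 < Gamma a)%R.
Proof.
move=> /andP[a0 a1]; rewrite /Gamma /Rintegral.
pose g t := (t `^ (a - 1) * expR (- t))%R.
have g0 t : (0 <= g t)%R by rewrite mulr_ge0 ?powR_ge0 ?expR_ge0.
have mg : measurable_fun [set: R] (EFin \o g).
  apply/measurable_EFinP/measurable_funM; first exact: measurable_powR.
  by apply: measurableT_comp => //; exact: measurable_oppr.
have gty : \int[mu]_(t in `]0%R, +oo[) (g t)%:E < +oo.
  apply: (@le_lt_trans _ _ (\int[mu]_t (((rlker a \_ `]0%R, 1%R]) t)%:E +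
    (exponential_pdf 1 t)%:E))).
    apply: (@le_trans _ _ (\int[mu]_(t in `]0%R, +oo[)
      (((rlker a \_ `]0%R, 1%R]) t)%:E + (exponential_pdf 1 t)%:E))).
      apply: ge0_le_integral => //.
      - by move=> t _; rewrite lee_fin.
      - exact: measurable_funTS.
      - apply: measurable_funTS; apply: emeasurable_funD;
        first exact: measurable_rlker01.
        by apply/measurable_EFinP; exact: measurable_exponential_pdf.
      move=> t /=; rewrite in_itv/= andbT => t0.
      have -> : exponential_pdf 1 t = expR (- t).
        by rewrite exponential_pdfE ?(ltW t0)//= mul1r mulN1r.
      rewrite -EFinD lee_fin.
      have [t1|t1] := leP t 1%R.
        rewrite -[leLHS]addr0 lerD ?expR_ge0// patchE ifT ?inE/= ?in_itv/=
          ?t0//.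
        rewrite /rlker t0 /g -[leRHS]mulr1 ler_wpM2l ?powR_ge0// -expR0
          ler_expR.
        by rewrite oppr_le0 ltW.
      rewrite -[leLHS]add0r lerD ?rlker01_ge0// /g -[leRHS]mul1r.
      by rewrite ler_wpM2r ?expR_ge0// -[leRHS](powRr0 t) ler_powR ?(ltW t1)//
        subr_le0.
    apply: ge0_subset_integral => //.
      apply: emeasurable_funD; first exact: measurable_rlker01.
      by apply/measurable_EFinP; exact: measurable_exponential_pdf.
    by move=> t _; rewrite adde_ge0// lee_fin ?rlker01_ge0 ?exponential_pdf_ge0.
  rewrite ge0_integralD//.
  - by rewrite integral_exponential_pdf// lte_add_pinfty//
    ?integral_rlker01_lty// ltry.
  - by move=> t _; rewrite lee_fin rlker01_ge0.
  - exact: measurable_rlker01.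
  - by move=> t _; rewrite lee_fin exponential_pdf_ge0.
  - by apply/measurable_EFinP; exact: measurable_exponential_pdf.
(* On ]0, 1[ the integrand is at least 1 * exp (- 1). *)
apply: fine_gt0; rewrite gty andbT.
apply: (@lt_le_trans _ _ (\int[mu]_(t in `]0%R, 1%R[) (cst (expR (- 1))%:E t))).
  rewrite integral_cst//= lebesgue_measure_itv/= lte_fin ltr01 sube0 mule1.
  by rewrite lte_fin expR_gt0.
apply: (@le_trans _ _ (\int[mu]_(t in `]0%R, 1%R[) (g t)%:E)).
  apply: ge0_le_integral => //.
  - by move=> t _; rewrite lee_fin expR_ge0.
  - exact: measurable_funTS.
  move=> t /=; rewrite in_itv/= => /andP[t0 t1]; rewrite lee_fin /g.
  rewrite -[leLHS]mul1r ler_pM ?expR_ge0// ?ler_expR ?lerN2 ?(ltW t1)//.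
  by rewrite -[leLHS](powRr0 t) ger_powR ?t0 ?(ltW t1)// subr_le0.
apply: ge0_subset_integral => //.
- exact: measurable_funTS.
- by move=> t _; rewrite lee_fin.
- by apply: subset_itvl; rewrite bnd_simp.
Qed.
End Kernel.

(** * Smooth functions and a flat one *)

Section Smooth.
Variable R : realType.
Implicit Types (f g : R -> R) (x y : R).

(** Differentiability [n] times, peeled off from the first derivative: this form
is the one that is stable under products and composition by induction. *)
Fixpoint Cn n f : Prop :=
  if n is m.+1 then (forall x, derivable f x 1) /\ Cn m (derive1 f) else True.

Definition smooth f := forall n, Cn n f.

Lemma CnW n f : Cn n.+1 f -> Cn n f.
Proof.
elim: n f => [//|n IH] f [df Cf]; split => //; exact: IH.
Qed.

Lemma smooth_derivable1n f n x : smooth f -> derivable (derive1n n f) x 1.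
Proof.
elim: n f => [|n IH] f sf; first by have [] := sf 1%N.
by rewrite derive1Sn; apply: IH => m; have [] := sf m.+1.
Qed.

Lemma Cn_is_derive n f (df : R -> R) :
  (forall x, is_derive x 1 f (df x)) -> Cn n df -> Cn n.+1 f.
Proof.
move=> fdf Cdf; split=> [x|]; first by have [] := fdf x.
suff -> : derive1 f = df by [].
by apply/funext => x; rewrite derive1E; have [_ ->] := fdf x.
Qed.

Lemma Cn_is_derive1 n f : Cn n.+1 f -> forall x, is_derive x 1 f (derive1 f x).
Proof. by move=> [df _] x; split => //; rewrite derive1E. Qed.

Lemma Cn_cst n (c : R) : Cn n (fun=> c).
Proof.
by elim: n c => [//|n IH] c; apply: Cn_is_derive (IH 0) => x.
Qed.

Lemma Cn_id n : Cn n (fun x => x).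
Proof.
by case: n => [//|n]; apply: Cn_is_derive (Cn_cst n 1) => x.
Qed.

Lemma CnD n f g : Cn n f -> Cn n g -> Cn n (fun x => f x + g x).
Proof.
elim: n f g => [//|n IH] f g Cf Cg.
apply: Cn_is_derive (IH _ _ Cf.2 Cg.2) => x.
exact: is_deriveD (Cn_is_derive1 Cf x) (Cn_is_derive1 Cg x).
Qed.

Lemma CnM n f g : Cn n f -> Cn n g -> Cn n (fun x => f x * g x).
Proof.
elim: n f g => [//|n IH] f g Cf Cg.
have : Cn n (fun x => f x * derive1 g x + g x * derive1 f x).
  by apply: CnD; apply: IH; [exact: CnW|exact: Cg.2|exact: CnW|exact: Cf.2].
apply: Cn_is_derive => x.
exact: is_deriveM (Cn_is_derive1 Cf x) (Cn_is_derive1 Cg x).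
Qed.

Lemma Cn_comp n f g : Cn n f -> Cn n g -> Cn n (fun x => f (g x)).
Proof.
elim: n f g => [//|n IH] f g Cf Cg.
have : Cn n (fun x => derive1 f (g x) * derive1 g x).
  by apply: CnM; [apply: IH; [exact: Cf.2|exact: CnW]|exact: Cg.2].
apply: Cn_is_derive => x.
exact: is_derive1_comp (Cn_is_derive1 Cf (g x)) (Cn_is_derive1 Cg x).
Qed.

(** The functions x^(- m) exp (- 1 / x), extended by 0.  The derivative of one
of them is a combination of two others, so all are shown to be smooth at
once. *)
Definition flat m x : R := if 0 < x then x^-1 ^+ m * expR (- x^-1) else 0.

Lemma flat_ge0 m x : 0 <= flat m x.
Proof.
rewrite /flat; case: ifPn => // x0.
by rewrite mulr_ge0 ?expR_ge0 ?exprn_ge0 ?invr_ge0 ?ltW.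
Qed.

(** The exponential series gives y^(m + 2) <= (m + 2)! exp y at y = 1 / x.  The
quadratic decay makes [flat m] differentiable at 0. *)
Lemma flat_le m x : flat m x <= m.+2`!%:R * x ^+ 2.
Proof.
rewrite /flat; case: ifPn => x0; last by rewrite mulr_ge0 ?sqr_ge0.
have y0 : 0 < x^-1 by rewrite invr_gt0.
have h : x^-1 ^+ m.+2 <= m.+2`!%:R * expR x^-1.
  rewrite mulrC -ler_pdivrMr ?ltr0n ?fact_gt0//.
  by apply: le_trans (expR_ge1Dxn m.+1 (ltW y0)); rewrite lerDr.
rewrite expRN ler_pdivrMr ?expR_gt0//.
have -> : x^-1 ^+ m = x ^+ 2 * x^-1 ^+ m.+2.
  by rewrite !exprS; field; rewrite gt_eqF.
by rewrite [leRHS]mulrAC [leLHS]mulrC; apply: ler_wpM2r => //; exact: sqr_ge0.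
Qed.

Lemma is_derive_flat m x :
  is_derive x 1 (flat m) (flat m.+2 x - m%:R * flat m.+1 x).
Proof.
have [x0|x0|->] := ltgtP x 0.
- rewrite /flat ltNge (ltW x0)/= mulr0 subr0.
  apply: (@near_eq_is_derive R R R (cst 0) _ x 1 0).
  near=> y; rewrite /= ifF//; apply/negbTE; rewrite -leNgt ltW//.
  by near: y; exact: lt_nbhsl.
- pose G y : R := y ^+ m * expR (- y).
  have dG y : is_derive y 1 G
      (m%:R * y ^+ m.-1 * expR (- y) - y ^+ m * expR (- y)).
    have d1 : is_derive y 1 (fun z : R => z ^+ m) (m%:R * y ^+ m.-1).
      have := @is_deriveX _ _ (@id R) m y 1 1 (is_derive_id _ _).
      by rewrite exprfctE /GRing.scale/= mulr1.
    have d2 : is_derive y 1 (fun z : R => expR (- z)) (- expR (- y)).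
      have := @is_derive1_comp _ expR (fun z : R => - z) y _ _
        (is_derive_expR _) (is_deriveNid _ _).
      by rewrite mulrN1.
    by apply: (is_derive_eq (is_deriveM d1 d2)); rewrite /GRing.scale/=; ring.
  have dV : is_derive x 1 (fun z : R => z^-1) (- x ^- 2).
    apply: DeriveDef; first by apply: derivableV => //; rewrite gt_eqF.
    by rewrite deriveV ?gt_eqF// derive_id /GRing.scale/= mulr1.
  apply: (@near_eq_is_derive _ _ _ (G \o (fun z : R => z^-1))).
    near=> y; rewrite /flat /= ifT//.
    by near: y; exact: lt_nbhsr.
  apply: (is_derive_eq (is_derive1_comp (dG _) dV)); rewrite /flat x0 -exprVn.
  case: m {G dG} => [|m]; last by rewrite /= !exprS; ring.
  by rewrite /= !exprS expr0; ring.
(* By flat_le the difference quotient at 0 is bounded by a multiple of h. *)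
- rewrite /flat ltxx mulr0 subr0 -/(flat m).
  have h : h^-1 *: (flat m (h *: 1 + 0) - flat m 0) @[h --> 0^'] --> (0 : R).
    apply/cvgrPdist_le => e e0; near=> h.
    rewrite sub0r normrN addr0 /GRing.scale/= mulr1 {2}/flat ltxx subr0.
    rewrite normrM normfV (ger0_norm (flat_ge0 _ _)).
    have h0 : 0 < `|h| by rewrite normr_gt0; near: h; exact: nbhs_dnbhs_neq.
    rewrite mulrC ler_pdivrMr// (le_trans (flat_le _ _))//.
    rewrite -(real_normK (num_real h)) expr2 mulrA ler_pM2r// mulrC
      -ler_pdivlMr ?ltr0n ?fact_gt0//.
    near: h; apply: dnbhs0_le.
    by rewrite divr_gt0// ltr0n fact_gt0.
  apply: DeriveDef; first by apply/cvg_ex; exists 0.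
  by rewrite /derive; apply/cvg_lim.
Unshelve. all: by end_near. Qed.

Lemma Cn_flat n m : Cn n (flat m).
Proof.
elim: n m => [//|n IH] m; apply: (Cn_is_derive (is_derive_flat m)).
apply: CnD; first exact: IH.
have -> : (fun x => - (m%:R * flat m.+1 x)) = (fun x => - m%:R * flat m.+1 x).
  by apply/funext => x; rewrite mulNr.
by apply: CnM; [exact: Cn_cst|exact: IH].
Qed.

Lemma smooth_continuous f : smooth f -> continuous f.
Proof.
move=> sf x; apply: differentiable_continuous; apply/derivable1_diffP.
by have [] := sf 1%N.
Qed.

End Smooth.

(** * Bumps and the test functions they generate *)

Section Bump.
Variable R : realType.
Local Notation mu := (@lebesgue_measure R).
Implicit Types (a b x T : R) (n : nat).

(** These bumps increase with [n] to the indicator of ]a, b[. *)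
Definition bumpf a b n x : R := flat 0 (n%:R * ((x - a) * (b - x))).

Lemma smooth_bump a b n : smooth (bumpf a b n).
Proof.
move=> m; rewrite (_ : bumpf a b n = fun x =>
  flat 0 (n%:R * ((x - a) * (b - x))))//.
apply: (@Cn_comp _ _ (flat 0) (fun x => n%:R * ((x - a) * (b - x)))).
  exact: Cn_flat.
apply: CnM; first exact: Cn_cst.
apply: CnM; apply: CnD; try exact: Cn_id; try exact: Cn_cst.
have -> : -%R = (fun x : R => -1 * x) by apply/funext => x; rewrite mulN1r.
by apply: CnM; [exact: Cn_cst|exact: Cn_id].
Qed.

Lemma bump_ge0 a b n x : 0 <= bumpf a b n x.
Proof. exact: flat_ge0. Qed.

Lemma flat0_le1 x : flat 0 x <= 1.
Proof.
rewrite /flat; case: ifP => // x0; rewrite expr0 mul1r -expR0 ler_expR.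
by rewrite oppr_le0 invr_ge0 ltW.
Qed.

Lemma bump_le1 a b n x : bumpf a b n x <= 1.
Proof. exact: flat0_le1. Qed.

Lemma flat0_homo : {homo @flat R 0 : x y / x <= y}.
Proof.
move=> x y xy; rewrite {1}/flat; case: ifPn => x0; last exact: flat_ge0.
rewrite /flat (lt_le_trans x0 xy) ler_pM ?expR_ge0 ?ler_expR ?exprn_ge0
  ?invr_ge0 ?(ltW x0)//.
by rewrite lerN2 lef_pV2 ?posrE// (lt_le_trans x0 xy).
Qed.

Lemma bump_out a b n x : a <= b -> x \notin `]a, b[ -> bumpf a b n x = 0.
Proof.
move=> ab; rewrite in_itv/= negb_and -!leNgt => xab.
rewrite /bumpf /flat ifF//; apply/negbTE; rewrite -leNgt mulr_ge0_le0//.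
by case/orP: xab => h; nra.
Qed.

Lemma bump_in a b x : x \in `]a, b[ -> bumpf a b n x @[n --> \oo] --> (1 : R).
Proof.
rewrite in_itv/= => /andP[ax xb].
pose y := (x - a) * (b - x).
have y0 : 0 < y by rewrite mulr_gt0 ?subr_gt0.
rewrite -cvg_shiftS/=.
have -> : (fun n => bumpf a b n.+1 x) = (fun n => expR (- (n.+1%:R^-1 * y^-1))).
  apply/funext => n; rewrite /bumpf /flat -/y mulr_gt0 ?ltr0n// expr0 mul1r.
  by rewrite invfM.
have e0 : - (0 * y^-1) = 0 :> R by rewrite mul0r oppr0.
have h : expR (- (n.+1%:R^-1 * y^-1)) @[n --> \oo] --> expR (- (0 * y^-1)).
  apply: continuous_cvg; first exact: continuous_expR.
  by apply: cvgN; apply: cvgMr_tmp; exact: (@cvg_harmonic R).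
by rewrite e0 expR0 in h.
Qed.

Lemma bump_homo a b x n m : a <= b -> (n <= m)%N ->
  bumpf a b n x <= bumpf a b m x.
Proof.
move=> ab nm; have [xab|xab] := boolP (x \in `]a, b[);
  last by rewrite !bump_out.
apply: flat0_homo; apply: ler_wpM2r; last by rewrite ler_nat.
by move: xab; rewrite in_itv/= => /andP[ax xb]; apply: mulr_ge0;
  rewrite subr_ge0 ltW.
Qed.

(** The test function generated by a bump supported in ]0, b[.  Its derivative
at x is eta (x + b) - eta x, which is - eta x for x >= 0, so it serves as a
primitive of - eta there, and unlike such a primitive it has compact support. *)
Definition window (eta : R -> R) b x : R := \int[mu]_(r in `]x, x + b]) eta r.

Section window.
Variables (eta : R -> R) (a b : R).
Hypotheses (a0 : 0 < a) (ab : a < b) (smooth_eta : smooth eta)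
  (eta0 : forall x, 0 <= eta x) (eta1 : forall x, eta x <= 1)
  (eta_out : forall x, x \notin `]a, b[ -> eta x = 0).

Let ceta : continuous eta := smooth_continuous smooth_eta.

Let meta : measurable_fun [set: R] eta.
Proof. exact: continuous_measurable_fun. Qed.

Lemma integrable_smooth_compact D : measurable D ->
  mu.-integrable D (EFin \o eta).
Proof.
move=> mD; apply: (@integrableS _ _ _ _ setT) => //.
apply/integrableP; split; first exact/measurable_EFinP.
pose c : R -> R := (cst (1 : R) : R -> R) \_ `[a, b].
apply: (@le_lt_trans _ _ (\int[mu]_x (c x)%:E)%E).
  apply: ge0_le_integral => //.
  - by apply: measurableT_comp => //; exact/measurable_EFinP.
  - by apply/measurable_EFinP/(measurable_restrictT _ _).1.
  - move=> x _ /=; rewrite lee_fin ger0_norm// /c patchE; case: ifPn => // xab.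
    rewrite eta_out//; apply: contra xab; rewrite inE/= !in_itv/= => /andP[? ?].
    by rewrite !ltW.
have -> : (\int[mu]_x (c x)%:E = \int[mu]_(x in `[a, b]) (cst 1%:E x))%E.
  by rewrite [RHS]integral_mkcond; apply: eq_integral => x _;
    rewrite /c !patchE; case: ifP.
by rewrite integral_cst//= lebesgue_measure_itv/= lte_fin ab -EFinD -EFinM ltry.
Qed.

Lemma is_derive_window x : is_derive x 1 (window eta b) (eta (x + b) - eta x).
Proof.
pose F x : R := \int[mu]_(r in `]-oo, x]) eta r.
have dF (y : R) : is_derive y 1 F (eta y).
  have [] := @continuous_FTC1 R eta -oo%O y (y + 1) _ _ _ _.
  - by rewrite ltrDl.
  - exact: integrable_smooth_compact.
  - exact: ltNyr.
  - exact: ceta.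
  by move=> dF <-; rewrite derive1E; apply: DeriveDef; first exact: dF.
have -> : window eta b = (F \o (fun z => z + b)) - F.
  apply/funext => z; rewrite /window -(@Rintegral_itvB _ eta -oo%O)//.
  - exact: integrable_smooth_compact.
  - by rewrite bnd_simp lerDl (le_trans (ltW a0) (ltW ab)).
apply: is_deriveB.
have dS : is_derive x 1 (fun z : R => z + b) 1.
  by have := is_deriveD (is_derive_id x 1) (is_derive_cst b x 1); rewrite addr0.
by have := @is_derive1_comp _ F (fun z : R => z + b) x _ _ (dF (x + b)) dS;
  rewrite mulr1.
Qed.

Lemma window_out x : x \notin `[a - b, b] -> window eta b x = 0.
Proof.
rewrite in_itv/= negb_and -!ltNge => xab.
rewrite /window (@eq_Rintegral _ _ _ mu _ (cst 0)) ?Rintegral_cst ?mul0r//.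
move=> r; rewrite inE/= in_itv/= => /andP[xr rxb]; apply: eta_out.
rewrite in_itv/= negb_and -!leNgt; case/orP: xab => h; apply/orP; [left|right];
  lra.
Qed.

Lemma test_function_window T : b < T -> test_function T (window eta b).
Proof.
move=> bT.
have cl : closure [set x | window eta b x != 0] `<=` `[a - b, b].
  have /closure_id -> : closed `[a - b, b]%classic by exact: interval_closed.
  apply: closureS => x /=; apply: contraR; move/window_out => ->.
  by rewrite eqxx.
split.
- move=> n x; apply: smooth_derivable1n => m.
  apply: CnW; apply: Cn_is_derive is_derive_window _.
  apply: CnD; last first.
    have -> : (fun x => - eta x) = (fun x => -1 * eta x).
      by apply/funext => y; rewrite mulN1r.
    by apply: CnM; [exact: Cn_cst|exact: smooth_eta].
  apply: (Cn_comp (smooth_eta m)).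
  by apply: CnD; [exact: Cn_id|exact: Cn_cst].
- apply: (subclosed_compact _ _ cl); first exact: closed_closure.
  exact: segment_compact.
- move=> x /cl /=; rewrite !in_itv/= => /andP[_ xb].
  exact: le_lt_trans bT.
Qed.

Lemma measurable_window : measurable_fun [set: R] (window eta b).
Proof.
apply: continuous_measurable_fun => x.
apply: differentiable_continuous; apply/derivable1_diffP.
by have [] := is_derive_window x.
Qed.

(** For x >= 0 the point x + b lies beyond the support of [eta], so the window
sees all the mass of [eta] to the right of x. *)
Lemma windowE x : 0 <= x ->
  ((window eta b x)%:E = \int[mu]_r ((rlker 1 (r - x))%:E * (eta r)%:E))%E.
Proof.
move=> x0; rewrite /window /Rintegral fineK; last first.
  by apply: integrable_fin_num => //; exact: integrable_smooth_compact.
rewrite integral_mkcond; apply: eq_integral => r _; rewrite patchE.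
case: ifPn => [|/negP]; rewrite inE/= in_itv/=.
  by move=> /andP[xr _]; rewrite rlker1 ?subr_gt0// mul1e.
move=> /negP; rewrite negb_and -leNgt -ltNge => /orP[rx|xbr].
  by rewrite rlkerE0 ?mul0e// subr_le0.
rewrite eta_out ?mule0// in_itv/= negb_and -!leNgt.
by rewrite (ltW (le_lt_trans _ xbr)) ?orbT// lerDr.
Qed.

End window.
End Bump.

(** * Almost everywhere equality from bumps *)

Section DuBoisReymond.
Variable R : realType.
Local Notation mu := (@lebesgue_measure R).
Implicit Types (a b x T M : R) (n : nat) (p q : R -> R).

Lemma measurable_bump a b n : measurable_fun [set: R] (bumpf a b n).
Proof.
by apply: continuous_measurable_fun; apply: smooth_continuous;
  exact: smooth_bump.
Qed.

(** The bumps increase with [n], so that monotone convergence applies. *)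
Lemma cvg_integral_bump a b p : a <= b -> measurable_fun [set: R] p ->
  (forall x, 0 <= p x) ->
  (\int[mu]_x ((bumpf a b n x)%:E * (p x)%:E) @[n --> \oo] -->
   \int[mu]_(x in `]a, b[) (p x)%:E)%E.
Proof.
move=> ab mp p0.
rewrite [X in _ --> X](_ : _ =
    \int[mu]_x limn (fun n => (bumpf a b n x)%:E * (p x)%:E))%E; last first.
  rewrite integral_mkcond; apply: eq_integral => x _; apply/esym/cvg_lim => //.
  rewrite patchE; case: ifPn => [|/negP]; rewrite inE/= => xab.
    have : (bumpf a b n x * p x)%:E @[n --> \oo] --> (1 * p x)%:E.
      apply: cvg_EFin; first exact: nearW.
      by apply: cvgMr_tmp; exact: bump_in.
    by rewrite mul1r.
  rewrite (_ : (fun _ => _) = cst 0%E); first exact: cvg_cst.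
  by apply/funext => n; rewrite bump_out ?mul0e//; apply/negP.
apply: cvg_monotone_convergence => //.
- move=> n; apply: emeasurable_funM; apply/measurable_EFinP => //.
  exact: measurable_bump.
- by move=> n x _; rewrite -EFinM lee_fin mulr_ge0 ?bump_ge0.
- by move=> x _ n m nm; rewrite -!EFinM lee_fin ler_wpM2r ?bump_homo.
Qed.

(** The primitive of the difference is constant on ]0, T[, and by the Lebesgue
differentiation theorem its derivative is the difference almost everywhere. *)
Lemma ae_eq_of_itv T M p q :
  measurable_fun [set: R] p -> measurable_fun [set: R] q ->
  (forall x, 0 <= p x) -> (forall x, 0 <= q x) ->
  (forall x, x < T -> p x <= M) -> (forall x, x < T -> q x <= M) ->
  (forall a b, 0 < a -> a < b -> b < T ->
    (\int[mu]_(x in `]a, b[) (p x)%:E = \int[mu]_(x in `]a, b[) (q x)%:E)%E) ->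
  {ae mu, forall x, 0 < x < T -> p x = q x}.
Proof.
move=> mp mq p0 q0 pM qM int_eq.
have intr (r : R -> R) (D : set (measurableTypeR R)) :
    measurable_fun [set: R] r -> (forall x, 0 <= r x) ->
    (forall x, x < T -> r x <= M) -> measurable D -> D `<=` `]0, T[ ->
    mu.-integrable D (EFin \o r).
  move=> mr r0 rM mD DT; apply/integrableP; split.
    by apply/measurable_EFinP; exact: measurable_funTS.
  apply: (@le_lt_trans _ _ (\int[mu]_(x in `]0%R, T[) (cst M%:E x))%E).
    apply: (@le_trans _ _ (\int[mu]_(x in `]0%R, T[) `|(r x)%:E|)%E).
      apply: ge0_subset_integral => //.
      by apply: measurable_funTS; apply: measurableT_comp => //;
        exact/measurable_EFinP.
    apply: ge0_le_integral => //.
    - by apply: measurable_funTS; apply: measurableT_comp => //;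
      exact/measurable_EFinP.
    - move=> x /=; rewrite in_itv/= => /andP[_ xT].
      by rewrite lee_fin ger0_norm ?rM.
  rewrite integral_cst//= lebesgue_measure_itv/= lte_fin.
  by case: ifPn => _; rewrite ?mule0 ?ltry// sube0 -EFinM ltry.
pose f : R -> R := (fun x => p x - q x) \_ `]0, T[.
have intpq (D : set (measurableTypeR R)) : measurable D -> D `<=` `]0, T[ ->
    mu.-integrable D (EFin \o (fun x => p x - q x)).
  by move=> mD DT;
    exact: (integrableB mD (intr p D mp p0 pM mD DT) (intr q D mq q0 qM mD DT)).
have mI : measurable (`]0, T[%classic : set (measurableTypeR R)).
  exact: measurable_itv.
have intf (D : set (measurableTypeR R)) : measurable D ->
  mu.-integrable D (EFin \o f).
  move=> mD; apply: (@integrableS _ _ _ _ setT) => //.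
  have : mu.-integrable `]0, T[ (EFin \o (fun x => p x - q x)) by exact: intpq.
  by move/(iffLR (integrable_mkcond _ mI)); rewrite restrict_EFin.
have := @FTC1Ny R f _ _.
move=> /(_ (fun y => intf _ (measurable_itv _))).
move=> /(_ (integrable_locally_restrict mI (intpq _ mI (@subset_refl _ _)))).
apply: filterS; first exact: (ae_filter_ringOfSetsType mu).
move=> x /=; set F := (fun _ => _) => -[_ Fx] xT.
suff : derive1 F x = 0.
  rewrite Fx /f patchE ifT ?inE/= ?in_itv//= => /eqP.
  by rewrite subr_eq0 => /eqP.
have Fcst y z : 0 < y -> y < z -> z < T -> F z = F y.
  move=> y0 yz zT; apply/eqP; rewrite -subr_eq0; apply/eqP.
  rewrite /F Rintegral_itvB//; [|exact: intf|by rewrite bnd_simp ltW].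
  rewrite -Rintegral_itv_bndo_bndc; last exact: intf.
  have sub : `]y, z[ `<=` `]0, T[.
    by move=> w; rewrite /= !in_itv/= => /andP[yw wz];
      rewrite (lt_trans y0) ?(lt_trans wz).
  rewrite (@eq_Rintegral _ _ _ mu _ (fun x => p x - q x)); last first.
    by move=> w /set_mem/sub wT; rewrite /f patchE mem_set.
  rewrite RintegralB//; [|exact: intr|exact: intr].
  by rewrite /Rintegral int_eq// subrr.
rewrite derive1E; apply: (@derive_val _ _ _ _ _ F).
apply: (@near_eq_is_derive R R R (cst (F x)) F x 1 0).
move: xT => /andP[x0 xT]; near=> y.
have y0 : 0 < y by near: y; exact: lt_nbhsr.
have yT : y < T by near: y; exact: lt_nbhsl.
by have [yx|yx|->//] := ltgtP x y; [rewrite (Fcst x)|rewrite (Fcst y)].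
Unshelve. all: by end_near. Qed.

Lemma ae_eq_of_bump T M p q :
  measurable_fun [set: R] p -> measurable_fun [set: R] q ->
  (forall x, 0 <= p x) -> (forall x, 0 <= q x) ->
  (forall x, x < T -> p x <= M) -> (forall x, x < T -> q x <= M) ->
  (forall a b n, 0 < a -> a < b -> b < T ->
    (\int[mu]_x ((bumpf a b n x)%:E * (p x)%:E) =
     \int[mu]_x ((bumpf a b n x)%:E * (q x)%:E))%E) ->
  {ae mu, forall x, 0 < x < T -> p x = q x}.
Proof.
move=> mp mq p0 q0 pM qM pq; apply: (ae_eq_of_itv mp mq p0 q0 pM qM) =>
  a b a0 ab bT.
have := cvg_integral_bump (ltW ab) mp p0.
under eq_fun do rewrite pq//.
by move=> h; apply: cvg_unique h (cvg_integral_bump (ltW ab) mq q0).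
Qed.

End DuBoisReymond.

(** * Fractional integrals and their transposes *)

Section FractionalIntegral.
Variable R : realType.
Local Notation mu := (@lebesgue_measure R).
Implicit Types (a b c s t x T M : R) (n : nat) (V : R -> R).
Local Open Scope ereal_scope.

(** The functions whose fractional integrals are taken below; the positive and
negative parts of a bounded measurable function supported in [0, +oo[ are of
this kind. *)
Definition tame M V : Prop :=
  [/\ measurable_fun [set: R] V, (forall x, 0 <= V x)%R,
      (forall x, V x <= M)%R & (forall s, s < 0 -> V s = 0)%R].

Lemma tame_ge0 M V : tame M V -> (0 <= M)%R.
Proof. by move=> [_ V0 VM _]; exact: le_trans (V0 0%R) (VM 0%R). Qed.

Lemma tame_parts M V : measurable_fun [set: R] V -> (forall x, `|V x| <= M)%R ->
  (forall s, s < 0 -> V s = 0)%R -> tame M V^\+%R /\ tame M V^\-%R.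
Proof.
move=> mV VM Vneg; split; split.
- exact: measurable_funrpos.
- by move=> x; exact: funrpos_ge0.
- by move=> x; rewrite ge_max (le_trans (ler_norm _) (VM x))
  (le_trans _ (VM x)).
- by move=> s s0; rewrite /funrpos Vneg// maxxx.
- exact: measurable_funrneg.
- by move=> x; exact: funrneg_ge0.
- by move=> x; rewrite ge_max (le_trans _ (VM x)) ?(le_trans _ (VM x))//
  ler_normr lexx orbT.
- by move=> s s0; rewrite /funrneg Vneg// oppr0 maxxx.
Qed.

(** The Riemann-Liouville fractional integral of order [a], without the factor
1 / Gamma a. *)
Definition rlint a V : R -> \bar R := convol (EFin \o rlker a) (EFin \o V).

Lemma rlint_ge0 a V t : (forall x, 0 <= V x)%R -> 0 <= rlint a V t.
Proof.
by move=> V0; apply: convol_ge0 => x; rewrite lee_fin// rlker_ge0.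
Qed.

Lemma measurable_rlint a V : measurable_fun [set: R] V ->
  (forall x, 0 <= V x)%R ->
  measurable_fun [set: R] (rlint a V).
Proof.
move=> mV V0; apply: measurable_convol.
- exact: measurable_rlkerE.
- exact/measurable_EFinP.
- by move=> x; rewrite lee_fin rlker_ge0.
- by move=> x; rewrite lee_fin.
Qed.

Lemma rlint_eq0 a V t : (t <= 0)%R -> (forall s, s < 0 -> V s = 0)%R ->
  rlint a V t = 0.
Proof.
move=> t0 V0; rewrite /rlint /convol; apply: integral0_eq => s _ /=.
have [s0|s0] := ltP s 0%R; first by rewrite V0// mule0.
by rewrite rlkerE0 ?mul0e// subr_le0 (le_trans t0).
Qed.

(** Only the values of V between c and t count, and there the kernel has mass at
most (t - c)^a / a, which is small when t - c is. *)
Lemma rlint_le a V c t M : (0 < a)%R -> (c < t)%R -> (0 <= M)%R ->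
  measurable_fun [set: R] V -> (forall x, 0 <= V x)%R ->
  (forall s, s < c -> V s = 0)%R -> (forall s, s < t -> V s <= M)%R ->
  rlint a V t <= (M * ((t - c) `^ a / a))%:E.
Proof.
move=> a0 ct M0 mV V0 Vc VM.
have mk := measurable_rlkerE a.
have k0 x : 0 <= (EFin \o rlker a) x by rewrite lee_fin rlker_ge0.
have mVE : measurable_fun [set: R] (EFin \o V) by exact/measurable_EFinP.
have VE0 x : 0 <= (EFin \o V) x by rewrite lee_fin.
rewrite /rlint convolC// /convol.
rewrite [leRHS]EFinM; apply: le_trans; last first.
  apply: lee_pmul (lexx _) (integral_rlker_le a0 _); last by rewrite subr_gt0.
  - by rewrite lee_fin.
  - by apply: integral_ge0 => x _; rewrite lee_fin rlker_ge0.
rewrite -ge0_integralZl//; last 2 first.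
- exact: measurable_funTS.
- by move=> x _; exact: k0.
rewrite [leRHS]integral_mkcond; apply: ge0_le_integral => //.
- by move=> x _; exact: mule_ge0.
- apply: emeasurable_funM => //; apply: measurableT_comp => //.
  exact: measurable_funB.
- apply/(measurable_restrictT _ _).1 => //.
  by apply: emeasurable_funM => //; exact: measurable_funTS.
move=> s _; rewrite patchE; case: ifPn => [|/negP]; rewrite inE/= in_itv/=.
  by move=> /andP[s0 _]; rewrite lee_fin ler_wpM2r ?rlker_ge0// VM// ltrBlDr
    ltrDl.
move=> /negP; rewrite negb_and -leNgt -ltNge => /orP[s0|ts].
  by rewrite rlkerE0// mule0.
by rewrite Vc ?mul0e// ltrBlDr -ltrBlDl.
Qed.

Lemma rlint_le_tame a M V t : (0 < a)%R -> tame M V -> (0 <= t)%R ->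
  rlint a V t <= (M * (t `^ a / a))%:E.
Proof.
move=> a0 VM; have M0 := tame_ge0 VM; have [mV V0 leM Vneg] := VM.
rewrite le_eqVlt => /predU1P[<-|t0].
  by rewrite rlint_eq0// lee_fin mulr_ge0// divr_ge0 ?powR_ge0// ltW.
by rewrite -[X in (M * (X `^ _ / _))%R]subr0; exact: rlint_le.
Qed.

Lemma rlint_fin_num a M V t : (0 < a)%R -> tame M V ->
  rlint a V t \is a fin_num.
Proof.
move=> a0 VM; have [mV V0 leM Vneg] := VM.
rewrite ge0_fin_numE ?rlint_ge0//.
have [t0|t0] := leP t 0%R; first by rewrite rlint_eq0// ltry.
by rewrite (le_lt_trans (rlint_le_tame a0 VM (ltW t0)))// ltry.
Qed.

Lemma rlint_le_itv a M V T t : (0 < a)%R -> tame M V -> (t < T)%R ->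
  (0 < T)%R ->
  rlint a V t <= (M * (T `^ a / a))%:E.
Proof.
move=> a0 VM; have M0 := tame_ge0 VM; have [mV V0 leM Vneg] := VM.
move=> tT T0; have [t0|t0] := leP t 0%R.
  by rewrite rlint_eq0// lee_fin mulr_ge0// divr_ge0 ?powR_ge0// ltW.
apply: (le_trans (rlint_le_tame a0 VM (ltW t0))).
rewrite lee_fin ler_wpM2l// ler_pM2r ?invr_gt0// ge0_ler_powR ?nnegrE
  ?(ltW a0)//.
all: exact: ltW.
Qed.

Section pairing.
Variables (a b c T : R) (eta : R -> R).
Hypotheses (a0 : (0 < a)%R) (b0 : (0 < b)%R) (bc : (b < c)%R) (cT : (c < T)%R)
  (meta : measurable_fun [set: R] eta)
  (eta0 : forall x, (0 <= eta x)%R) (eta1 : forall x, (eta x <= 1)%R)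
  (eta_out : forall x, x \notin `]b, c[ -> eta x = 0%R).

(** The transpose of [rlint a], applied to [eta]: only the future of t counts. *)
Definition dual_rlint t : \bar R :=
  \int[mu]_r ((rlker a (r - t))%:E * (eta r)%:E).

Let mk t : measurable_fun [set: R] (fun r => (rlker a (r - t))%:E * (eta r)%:E).
Proof.
apply: emeasurable_funM; last exact/measurable_EFinP.
apply/measurable_EFinP/measurableT_comp; first exact: measurable_rlker.
exact: measurable_funB.
Qed.

Lemma dual_rlint_shift t :
  \int[mu]_s (rlker a s * eta (s + t))%:E = dual_rlint t.
Proof.
rewrite /dual_rlint [RHS](@ge0_integral_affine _ 1 t)// ?mul1e.
- by apply: eq_integral => s _; rewrite mul1r addrK EFinM.
- by move=> r; rewrite -EFinM lee_fin mulr_ge0 ?rlker_ge0.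
Qed.

Lemma dual_rlint_fin_num t : dual_rlint t \is a fin_num.
Proof.
rewrite ge0_fin_numE; last first.
  by apply: integral_ge0 => r _; rewrite -EFinM lee_fin mulr_ge0 ?rlker_ge0.
rewrite -dual_rlint_shift.
have [ct|tc] := leP c t.
  rewrite integral0_eq ?ltry// => s _.
  have [s0|s0] := leP s 0%R; first by rewrite rlkerE0// mul0r.
  by rewrite eta_out ?mulr0// in_itv/= negb_and -!leNgt orbC ler_wpDl// ltW.
apply: (@le_lt_trans _ _ (\int[mu]_(s in `]0%R, (c - t)%R]) (rlker a s)%:E));
  last first.
  by rewrite (le_lt_trans (integral_rlker_le a0 _)) ?subr_gt0// ltry.
rewrite [leRHS]integral_mkcond; apply: ge0_le_integral => //.
- by move=> s _; rewrite lee_fin mulr_ge0 ?rlker_ge0.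
- apply/measurable_EFinP/measurable_funM; first exact: measurable_rlker.
  by apply: measurableT_comp => //; exact: measurable_funD.
- apply/(measurable_restrictT _ _).1 => //.
  by apply: measurable_funTS; exact: measurable_rlkerE.
move=> s _; rewrite patchE; case: ifPn => [|/negP]; rewrite inE/= in_itv/=.
  by move=> _; rewrite lee_fin -[leRHS]mulr1 ler_wpM2l ?rlker_ge0.
move=> /negP; rewrite negb_and -leNgt -ltNge => /orP[s0|ts].
  by rewrite rlkerE0// mul0r.
rewrite eta_out ?mulr0// in_itv/= negb_and -!leNgt orbC -lerBlDr.
by rewrite (ltW ts).
Qed.

Lemma pairing_fin_num M V : tame M V ->
  \int[mu]_r ((eta r)%:E * rlint a V r) \is a fin_num.
Proof.
move=> tV; have [mV V0 VM Vneg] := tV.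
rewrite ge0_fin_numE; last first.
  by apply: integral_ge0 => r _; rewrite mule_ge0 ?rlint_ge0 ?lee_fin.
have T0 : (0 < T)%R by rewrite (lt_trans b0)// (lt_trans bc).
pose K := (M * (T `^ a / a))%R.
apply: (@le_lt_trans _ _ (\int[mu]_(r in `]b, c[) (cst K%:E r))).
  rewrite [leRHS]integral_mkcond; apply: ge0_le_integral => //.
  - by move=> r _; rewrite mule_ge0 ?rlint_ge0 ?lee_fin.
  - by apply: emeasurable_funM;
    [exact/measurable_EFinP|exact: measurable_rlint].
  - by apply/(measurable_restrictT _ _).1.
  move=> r _; rewrite patchE; case: ifPn => [|/negP]; rewrite inE/=; last first.
    by move=> /negP rbc; rewrite eta_out// mul0e.
  rewrite in_itv/= => /andP[br rc].
  rewrite -[leRHS]mul1e lee_pmul ?rlint_ge0// ?lee_fin//.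
  exact: (rlint_le_itv a0 tV (lt_trans rc cT)).
by rewrite integral_cst//= lebesgue_measure_itv/= lte_fin bc -EFinB -EFinM ltry.
Qed.

(** Transposition of the fractional integral for a signed function.  The
integral on the left is by definition a difference of two integrals of
nonnegative functions; both are finite, and [convol_adj] applies to each. *)
Lemma pairing M V : measurable_fun [set: R] V ->
  (forall x, `|V x| <= M)%R -> (forall s, s < 0 -> V s = 0)%R ->
  (\int[mu]_t (V t * fine (dual_rlint t)))%R =
  (fine (\int[mu]_r ((eta r)%:E * rlint a V^\+%R r)) -
   fine (\int[mu]_r ((eta r)%:E * rlint a V^\-%R r)))%R.
Proof.
move=> mV VM Vneg.
have mVp := measurable_funrpos mV.
have mVm := measurable_funrneg mV.
have adj (W : R -> R) : measurable_fun [set: R] W -> (forall x, 0 <= W x)%R ->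
    \int[mu]_t (W t * fine (dual_rlint t))%:E =
    \int[mu]_r ((eta r)%:E * rlint a W r).
  move=> mW W0.
  have mWE : measurable_fun [set: R] (EFin \o W) by exact/measurable_EFinP.
  have meE : measurable_fun [set: R] (EFin \o eta) by exact/measurable_EFinP.
  have mkE := measurable_rlkerE a.
  have WE0 x : 0 <= (EFin \o W) x by rewrite lee_fin.
  have eE0 x : 0 <= (EFin \o eta) x by rewrite lee_fin.
  have kE0 x : 0 <= (EFin \o rlker a) x by rewrite lee_fin rlker_ge0.
  transitivity (\int[mu]_t ((EFin \o W) t * dual_rlint t)).
    by apply: eq_integral => t _; rewrite EFinM fineK// dual_rlint_fin_num.
  exact: convol_adj.
have d0 t : (0 <= fine (dual_rlint t))%R.
  apply: fine_ge0; apply: integral_ge0 => r _.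
  by rewrite -EFinM lee_fin mulr_ge0 ?rlker_ge0.
have [tVp tVm] := tame_parts mV VM Vneg.
rewrite /Rintegral integralE -fineB;
  [|exact: pairing_fin_num tVp|exact: pairing_fin_num tVm].
congr (fine (_ - _)).
- rewrite -adj//; apply: eq_integral => t _.
  by rewrite funeposE/= /funrpos -EFin_max maxr_pMl// mul0r.
- rewrite -adj//; apply: eq_integral => t _.
  by rewrite funenegE/= /funrneg -EFin_max maxr_pMl// mul0r mulNr.
Qed.
End pairing.
End FractionalIntegral.

(** * Inversion of the Abel equation *)

Section Abel.
Variable R : realType.
Local Notation mu := (@lebesgue_measure R).
Implicit Types (a b c s t x T M : R) (n : nat) (V W H : R -> R).
Local Open Scope ereal_scope.

Lemma fine_subE (x y z w : \bar R) : x \is a fin_num -> y \is a fin_num ->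
  z \is a fin_num -> w \is a fin_num ->
  (fine x - fine y = fine z - fine w)%R -> x + w = y + z.
Proof.
move: x y z w => [x||] [y||] [z||] [w||] // _ _ _ _ /= e.
by rewrite -!EFinD; congr EFin; lra.
Qed.

Lemma fin_addeI (x y z : \bar R) : x \is a fin_num -> x + y = x + z -> y = z.
Proof. by move: x y z => [x||] [y||] [z||] // _ [] /addrI ->. Qed.

Lemma rlint1_split V b c : measurable_fun [set: R] V ->
  (forall x, 0 <= V x)%R ->
  (b < c)%R -> rlint 1 V c = rlint 1 V b + \int[mu]_(x in `]b, c[) (V x)%:E.
Proof.
move=> mV V0 bc; have mVE : measurable_fun [set: R] (EFin \o V)
  by exact/measurable_EFinP.
rewrite integral_itv_obnd_cbnd; last exact: measurable_funTS.
rewrite integral_mkcond /rlint /convol -ge0_integralD//=.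
- apply: eq_integral => s _; rewrite patchE.
  case: ifPn => [|/negP]; rewrite inE/= in_itv/=.
    move=> /andP[bs sc]; rewrite rlker1 ?subr_gt0// mul1e.
    by rewrite rlkerE0 ?subr_le0// mul0e add0e.
  move=> /negP; rewrite negb_and -ltNge -leNgt => /orP[sb|cs]; rewrite adde0.
    by rewrite !rlker1 ?subr_gt0// (lt_trans sb).
  by rewrite !rlkerE0 ?subr_le0// (le_trans (ltW bc)).
- by move=> s _; rewrite mule_ge0 ?lee_fin ?rlker_ge0.
- by apply: emeasurable_funM => //; exact: measurable_rlkerB.
- by move=> s _; rewrite patchE; case: ifP => // _; rewrite lee_fin.
- by apply/(measurable_restrictT _ _).1 => //; exact: measurable_funTS.
Qed.

Section inversion.
Variables (gamma T M : R) (W1 W2 H1 H2 : R -> R).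
Hypotheses (g0 : (0 < gamma)%R) (g1 : (gamma < 1)%R) (T0 : (0 < T)%R)
  (tW1 : tame M W1) (tW2 : tame M W2) (tH1 : tame M H1) (tH2 : tame M H2).

(** Abel's equation, from its integrals against all bumps.  The hypothesis is an
equality of differences; moving the negative terms to the other side makes both
sides integrals of a bump against a nonnegative bounded function. *)
Lemma ae_eq_of_pairing :
  (forall b c n, 0 < b -> b < c -> c < T ->
   fine (\int[mu]_r ((bumpf b c n r)%:E * rlint (1 - gamma) W1 r)) -
   fine (\int[mu]_r ((bumpf b c n r)%:E * rlint (1 - gamma) W2 r)) =
   fine (\int[mu]_r ((bumpf b c n r)%:E * rlint 1 H1 r)) -
   fine (\int[mu]_r ((bumpf b c n r)%:E * rlint 1 H2 r)))%R ->
  {ae mu, forall x, (0 < x < T)%R ->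
    rlint (1 - gamma) W1 x + rlint 1 H2 x =
    rlint (1 - gamma) W2 x + rlint 1 H1 x}.
Proof.
have a0 : (0 < 1 - gamma)%R by rewrite subr_gt0.
have aux W H : tame M W -> tame M H ->
   let p x := fine (rlint (1 - gamma) W x + rlint 1 H x) in
   [/\ measurable_fun [set: R] p, (forall x, 0 <= p x)%R,
     (forall x, x < T ->
       p x <= M * (T `^ (1 - gamma) / (1 - gamma)) + M * (T `^ 1 / 1))%R &
     forall x, (p x)%:E = rlint (1 - gamma) W x + rlint 1 H x].
  move=> tW tH p.
  have [mW W0 WM Wneg] := tW; have [mH H0 HM Hneg] := tH.
  have pE x : (p x)%:E = rlint (1 - gamma) W x + rlint 1 H x.
    by rewrite /p fineK// fin_numD (rlint_fin_num _ a0 tW)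
      (rlint_fin_num _ ltr01 tH).
  split => // [|x|x xT].
  - by apply: measurableT_comp => //; apply: emeasurable_funD;
    exact: measurable_rlint.
  - by rewrite -lee_fin pE adde_ge0// rlint_ge0.
  - rewrite -lee_fin pE EFinD leeD//; [exact: rlint_le_itv|exact: rlint_le_itv].
have [mp p0 pK pE] := aux _ _ tW1 tH2.
have [mq q0 qK qE] := aux _ _ tW2 tH1.
set p := (fun x => _) in mp p0 pK pE; set q := (fun x => _) in mq q0 qK qE.
move=> eqWH.
suff : {ae mu, forall x, (0 < x < T)%R -> p x = q x}.
  apply: filterS; first exact: (ae_filter_ringOfSetsType mu).
  by move=> x /= pq xT; rewrite -pE -qE; congr EFin; exact: pq.
apply: (ae_eq_of_bump mp mq p0 q0 pK qK) => b c n b0 bc cT.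
have mb : measurable_fun [set: R] (fun x => (bumpf b c n x)%:E).
  by apply/measurable_EFinP; exact: measurable_bump.
have fin a V : (0 < a)%R -> tame M V ->
    \int[mu]_r ((bumpf b c n r)%:E * rlint a V r) \is a fin_num.
  move=> a_gt0 tV; apply: (pairing_fin_num a_gt0 b0 bc cT _ _ _ _ tV).
  - exact: measurable_bump.
  - exact: bump_ge0.
  - exact: bump_le1.
  - by move=> x; apply: bump_out; exact: ltW.
have add W H : tame M W -> tame M H ->
    \int[mu]_x ((bumpf b c n x)%:E * (rlint (1 - gamma) W x + rlint 1 H x)) =
    \int[mu]_r ((bumpf b c n r)%:E * rlint (1 - gamma) W r) +
    \int[mu]_r ((bumpf b c n r)%:E * rlint 1 H r).
  move=> [mW W0 _ _] [mH H0 _ _].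
  rewrite -ge0_integralD//.
  - by apply: eq_integral => x _; rewrite ge0_muleDr// rlint_ge0.
  - by move=> x _; rewrite mule_ge0 ?rlint_ge0// lee_fin bump_ge0.
  - by apply: emeasurable_funM => //; exact: measurable_rlint.
  - by move=> x _; rewrite mule_ge0 ?rlint_ge0// lee_fin bump_ge0.
  - by apply: emeasurable_funM => //; exact: measurable_rlint.
under eq_integral do rewrite pE.
under [RHS]eq_integral do rewrite qE.
rewrite (add _ _ tW1 tH2) (add _ _ tW2 tH1).
exact: (fine_subE (fin _ W1 a0 tW1) (fin _ W2 a0 tW2) (fin _ H1 ltr01 tH1)
  (fin _ H2 ltr01 tH2) (eqWH b c n b0 bc cT)).
Qed.

(** Convolving Abel's equation with s^(gamma - 1) turns s^(- gamma) * W into a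
multiple of 1 * W, and 1 * H into 1 * (s^(gamma - 1) * H).  Both sides are then
primitives, whose densities agree almost everywhere. *)
Lemma abel_inversion :
  {ae mu, forall x, (0 < x < T)%R ->
    rlint (1 - gamma) W1 x + rlint 1 H2 x =
    rlint (1 - gamma) W2 x + rlint 1 H1 x} ->
  {ae mu, forall x, (0 < x < T)%R ->
    (fine (beta gamma (1 - gamma)) * W1 x)%:E + rlint gamma H2 x =
    (fine (beta gamma (1 - gamma)) * W2 x)%:E + rlint gamma H1 x}.
Proof.
have a0 : (0 < 1 - gamma)%R by rewrite subr_gt0.
set B := fine _.
have B0 : (0 <= B)%R.
  apply: fine_ge0; apply: le_trans (beta_ge1 _ _); rewrite ?(ltW g1)//.
  by rewrite gerBl ltW.
have BE : beta gamma (1 - gamma) = B%:E.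
  rewrite /B fineK// ge0_fin_numE ?beta_lty//.
  apply: le_trans (beta_ge1 _ _); rewrite ?(ltW g1)//.
  by rewrite gerBl ltW.
clearbody B.
pose k := EFin \o @rlker R gamma; pose l := EFin \o @rlker R (1 - gamma).
pose th := EFin \o @rlker R 1.
have ker0 a x : 0 <= (EFin \o rlker a) x by rewrite lee_fin rlker_ge0.
have k0 : forall x, 0 <= k x := ker0 gamma.
have l0 : forall x, 0 <= l x := ker0 (1 - gamma)%R.
have th0 : forall x, 0 <= th x := ker0 1%R.
have mk : measurable_fun [set: R] k by exact: measurable_rlkerE.
have ml : measurable_fun [set: R] l by exact: measurable_rlkerE.
have mth : measurable_fun [set: R] th by exact: measurable_rlkerE.
have kl : convol k l = fun t => B%:E * th t.
  apply/funext => t; rewrite convol_rlker BE.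
  by rewrite (_ : gamma + (1 - gamma) = 1)%R//; ring.
have conv_eq W H x : tame M W -> tame M H ->
    convol k (fun y => rlint (1 - gamma) W y + rlint 1 H y) x =
    rlint 1 (fun y => B * W y + fine (rlint gamma H y))%R x.
  move=> tW tH; have [mW W0 WM Wneg] := tW; have [mH H0 HM Hneg] := tH.
  have mWE : measurable_fun [set: R] (EFin \o W) by exact/measurable_EFinP.
  have mHE : measurable_fun [set: R] (EFin \o H) by exact/measurable_EFinP.
  have WE0 y : 0 <= (EFin \o W) y by rewrite lee_fin.
  have HE0 y : 0 <= (EFin \o H) y by rewrite lee_fin.
  have mlW : measurable_fun [set: R] (convol l (EFin \o W))
    by exact: measurable_convol.
  have mthH : measurable_fun [set: R] (convol th (EFin \o H))
    by exact: measurable_convol.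
  have mkH : measurable_fun [set: R] (convol k (EFin \o H))
    by exact: measurable_convol.
  have lW0 y : 0 <= convol l (EFin \o W) y by exact: convol_ge0.
  have thH0 y : 0 <= convol th (EFin \o H) y by exact: convol_ge0.
  have kH0 y : 0 <= convol k (EFin \o H) y by exact: convol_ge0.
  have mBW : measurable_fun [set: R] (fun y => B%:E * (EFin \o W) y).
    exact: emeasurable_funM.
  have BW0 y : 0 <= B%:E * (EFin \o W) y by rewrite mule_ge0 ?lee_fin.
  rewrite (convolDr mk mlW mthH)// (convolA mk ml mWE)// kl convolZl//.
  rewrite (convolA mk mth mHE)// (_ : convol k th = convol th k); last first.
    by apply/funext => y; rewrite convolC.
  rewrite -(convolA mth mk mHE)// -convolZr// -convolDr//.
  congr (convol _ _ x); apply/funext => y /=.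
  by rewrite EFinD EFinM fineK//; exact: (rlint_fin_num _ g0 tH).
move=> pq.
have aux W H : tame M W -> tame M H ->
   let p x := (B * W x + fine (rlint gamma H x))%R in
   [/\ measurable_fun [set: R] p, (forall x, 0 <= p x)%R,
     (forall x, x < T -> p x <= B * M + M * (T `^ gamma / gamma))%R,
     (forall x, (x < T)%R -> rlint 1 p x \is a fin_num) &
     forall x, (p x)%:E = (B * W x)%:E + rlint gamma H x].
  move=> tW tH p; have [mW W0 WM Wneg] := tW; have [mH H0 HM Hneg] := tH.
  have mp : measurable_fun [set: R] p.
    apply: measurable_funD; first exact: measurable_funM.
    by apply: measurableT_comp => //; exact: measurable_rlint.
  have p0 x : (0 <= p x)%R.
    by rewrite addr_ge0 ?mulr_ge0 ?fine_ge0 ?rlint_ge0.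
  have pK x : (x < T)%R -> (p x <= B * M + M * (T `^ gamma / gamma))%R.
    move=> xT; rewrite lerD ?ler_wpM2l// -lee_fin fineK;
      last exact: rlint_fin_num tH.
    exact: rlint_le_itv.
  have p_neg s : (s < 0)%R -> p s = 0%R.
    by move=> s0; rewrite /p Wneg// mulr0 add0r rlint_eq0// ltW.
  split => // x.
  - move=> xT; rewrite ge0_fin_numE ?rlint_ge0//.
    have [x0|x0] := leP x 0%R; first by rewrite rlint_eq0// ltry.
    apply: le_lt_trans (ltry _).
    apply: (@rlint_le _ 1 p 0 x (B * M + M * (T `^ gamma / gamma))) => //.
      by rewrite (le_trans (p0 x)) ?pK.
    by move=> s sx; apply: pK; exact: lt_trans xT.
  - by rewrite /p EFinD fineK//; exact: rlint_fin_num tH.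
have [mp p0 pK pfin pE] := aux _ _ tW1 tH2.
have [mq q0 qK qfin qE] := aux _ _ tW2 tH1.
(* At x < T the kernel only sees times s < T, where the hypothesis applies
   or where all terms vanish because s <= 0. *)
have key x : (x < T)%R ->
    rlint 1 (fun y => B * W1 y + fine (rlint gamma H2 y))%R x =
    rlint 1 (fun y => B * W2 y + fine (rlint gamma H1 y))%R x.
  move=> xT; rewrite -(conv_eq _ _ _ tW1 tH2) -(conv_eq _ _ _ tW2 tH1).
  have mint W H : tame M W -> tame M H ->
      measurable_fun [set: R] (fun s =>
        k (x - s)%R * (rlint (1 - gamma) W s + rlint 1 H s)).
    move=> [mW W0 _ _] [mH H0 _ _]; apply: emeasurable_funM;
      first exact: measurable_rlkerB.
    by apply: emeasurable_funD; exact: measurable_rlint.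
  apply: ae_eq_integral => //; [exact: mint|exact: mint|].
  move: pq; apply: filterS; first exact: (ae_filter_ringOfSetsType mu).
  move=> s /= pqs _.
  have [s0|s0] := leP s 0%R.
    have [_ _ _ ?] := tW1; have [_ _ _ ?] := tW2.
    have [_ _ _ ?] := tH1; have [_ _ _ ?] := tH2.
    by rewrite !rlint_eq0.
  have [sT|Ts] := ltP s T; first by rewrite pqs// s0.
  by rewrite /k /= rlkerE0 ?mul0e// subr_le0 (le_trans (ltW xT)).
suff : {ae mu, forall x, (0 < x < T)%R ->
    B * W1 x + fine (rlint gamma H2 x) = B * W2 x + fine (rlint gamma H1 x)}%R.
  apply: filterS; first exact: (ae_filter_ringOfSetsType mu).
  by move=> x /= e xT; rewrite -pE -qE; congr EFin; exact: e.
apply: (ae_eq_of_itv mp mq p0 q0 pK qK) => b c b0 bc cT.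
have := key _ cT; rewrite (rlint1_split mp p0 bc) (rlint1_split mq q0 bc).
rewrite (key b (lt_trans bc cT)).
exact/fin_addeI/qfin/(lt_trans bc cT).
Qed.
End inversion.
End Abel.

(** * From the distributional equation to the Volterra equation *)

Section WeakForm.
Variable R : realType.
Local Notation mu := (@lebesgue_measure R).
Implicit Types (b c s t x T M : R) (n : nat).

Section caputo_window.
Variables (gamma T u0 b c : R) (u eta : R -> R).
Hypotheses (g0 : 0 < gamma)
  (b0 : 0 < b) (bc : b < c) (smooth_eta : smooth eta)
  (eta0 : forall x, 0 <= eta x) (eta1 : forall x, eta x <= 1)
  (eta_out : forall x, x \notin `]b, c[ -> eta x = 0).

Let meta : measurable_fun [set: R] eta.
Proof. by apply: continuous_measurable_fun; exact: smooth_continuous. Qed.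

(** The inner pairing of the Caputo derivative with a test function.  As t is
nonnegative, only the decreasing part of the window is seen, and its slope is
- eta. *)
Lemma g_neg_window t : 0 <= t ->
  g_neg gamma (fun s => window eta c (s + t)) =
  (Gamma (1 - gamma))^-1 * fine (dual_rlint (1 - gamma) eta t).
Proof.
move=> t0; rewrite /g_neg /distD /regular_dist /Rintegral -fineN.
congr (_ * fine _).
rewrite -dual_rlint_shift//.
under eq_integral => s _.
  rewrite (_ : _ * _ = - (rlker (1 - gamma) s * eta (s + t))); last first.
    rewrite /rlker /heaviside; have [s0|s0|<-] := ltgtP 0 s.
    - rewrite mul1r -mulrN.
      have dS : is_derive s 1 (fun z : R => z + t) 1.
        by have := is_deriveD (is_derive_id s 1) (is_derive_cst t s 1);
          rewrite addr0.
      have dw := is_derive_window b0 bc smooth_eta eta0 eta1 eta_out (s + t).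
      have := @is_derive1_comp _ (window eta c) (fun z : R => z + t) s _ _ dw
        dS.
      rewrite mulr1 => d; rewrite derive1E (@derive_val _ _ _ _ _ _ _ d).
      rewrite (_ : eta (s + t + c) = 0) ?sub0r; last first.
        by rewrite eta_out// in_itv/= negb_and -!leNgt lerDr addr_ge0 ?orbT//
          ltW.
      by congr (_ `^ _ * _); ring.
    - by rewrite !mul0r oppr0.
    - by rewrite powR0 ?oppr_eq0 ?gt_eqF// mulr0 !mul0r oppr0.
  rewrite EFinN; over.
rewrite integral_ge0N; first by rewrite oppeK.
by move=> s _; rewrite lee_fin mulr_ge0 ?rlker_ge0.
Qed.

Lemma caputo_window : caputo gamma T u0 u (window eta c) =
  \int[mu]_t (((fun t => (Gamma (1 - gamma))^-1 * (u t - u0)) \_ `[0, T[) t *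
              fine (dual_rlint (1 - gamma) eta t)).
Proof.
rewrite /caputo /conv_dist Rintegral_mkcond; apply: eq_Rintegral => t _.
rewrite !patchE.
case: ifPn => [|/negP]; rewrite inE/= in_itv/= => tT; last first.
  by rewrite ifF ?mul0r//; apply/negbTE/negP; rewrite inE/= in_itv/= => /andP[].
case: ifPn => [|/negP]; rewrite inE/= in_itv/= ?tT ?andbT => t0.
  by rewrite g_neg_window// /heaviside t0 mulr1; ring.
by rewrite /heaviside ifF ?mulr0 ?mul0r//; exact/negbTE/negP.
Qed.

End caputo_window.

(** The weak equation tested against the window of a bump: both sides become
pairings with transposed fractional integrals, of orders 1 - gamma and 1. *)
Lemma strong_solution_weak gamma (f : R -> R) u0 T u b c n :
  0 < gamma -> gamma < 1 -> 0 < b -> b < c -> c < T ->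
  measurable_fun [set: R] ((f \o u) \_ `]0, T[) ->
  strong_solution gamma f u0 T u ->
  \int[mu]_t (((fun t => (Gamma (1 - gamma))^-1 * (u t - u0)) \_ `[0, T[) t *
              fine (dual_rlint (1 - gamma) (bumpf b c n) t)) =
  \int[mu]_t (((f \o u) \_ `]0, T[) t * fine (dual_rlint 1 (bumpf b c n) t)).
Proof.
move=> g0 g1 b0 bc cT mH [_ _ [h [hint hphi hf]]].
have bout x : x \notin `]b, c[ -> bumpf b c n x = 0 by exact: bump_out (ltW bc).
have sm := @smooth_bump R b c n.
rewrite -(@caputo_window _ T u0 b c u _ g0 b0 bc sm (bump_ge0 b c n)
  (bump_le1 b c n) bout).
have tf := test_function_window b0 bc sm (bump_ge0 b c n) (bump_le1 b c n)
  bout cT.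
have mw := measurable_window b0 bc sm (bump_ge0 b c n) (bump_le1 b c n) bout.
rewrite (hphi _ tf).
transitivity (\int[mu]_(t in `]0, T[) (f (u t) * window (bumpf b c n) c t)).
  congr fine; apply: ae_eq_integral => //.
  - apply/measurable_EFinP/measurable_funM.
      by case/integrableP: hint => /measurable_EFinP.
    exact: measurable_funTS.
  - apply/measurable_EFinP/measurable_funM.
      by apply/(measurable_restrictT _ _).2.
    exact: measurable_funTS.
  move: hf; apply: filterS; first exact: (ae_filter_ringOfSetsType mu).
  by move=> x /= hx xT; rewrite hx// inE.
rewrite Rintegral_mkcond; apply: eq_Rintegral => t _; rewrite !patchE.
case: ifPn => [|_]; rewrite ?mul0r// inE/= in_itv/= => /andP[t0 tT].
congr (_ * _); rewrite /dual_rlint.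
rewrite -(@windowE R (bumpf b c n) b c)//;
  [exact: bump_ge0|exact: bump_le1|exact: ltW].
Qed.

(** The constant K of the Volterra equation.  By the reflection formula it is
Gamma gamma. *)
Definition volterra_const gamma : R :=
  fine (beta gamma (1 - gamma)) * (Gamma (1 - gamma))^-1.

Lemma volterra_const_gt0 gamma : 0 < gamma -> gamma < 1 ->
  0 < volterra_const gamma.
Proof.
move=> g0 g1; rewrite mulr_gt0 ?invr_gt0 ?Gamma_gt0//; last by apply/andP; lra.
apply: fine_gt0; rewrite beta_lty ?subr_gt0// andbT.
by apply: lt_le_trans (beta_ge1 _ _) => //; [exact: ltW|lra].
Qed.

(** The bounds by [M] are those of a continuous solution on a compact interval.
They keep all fractional integrals finite, so that the equation between
nonnegative terms can be returned to the reals. *)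
Lemma strong_solution_volterra gamma (f : R -> R) u0 T M u :
  0 < gamma -> gamma < 1 -> 0 < T ->
  measurable_fun [set: R]
    ((fun t => (Gamma (1 - gamma))^-1 * (u t - u0)) \_ `[0, T[) ->
  measurable_fun [set: R] ((f \o u) \_ `]0, T[) ->
  (forall t, 0 <= t < T -> `|(Gamma (1 - gamma))^-1 * (u t - u0)| <= M) ->
  (forall t, 0 < t < T -> `|f (u t)| <= M) ->
  strong_solution gamma f u0 T u ->
  {ae mu, forall x, 0 < x < T ->
    volterra_const gamma * (u x - u0) =
    fine (rlint gamma ((f \o u) \_ `]0%R, T[)^\+ x) -
    fine (rlint gamma ((f \o u) \_ `]0%R, T[)^\- x)}.
Proof.
move=> g0 g1 T0; set W := _ \_ _; set H := _ \_ _ => mW mH WM' HM' sol.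
have M0 : 0 <= M by apply: le_trans (WM' 0 _); rewrite ?lexx ?T0.
have WM x : `|W x| <= M.
  rewrite /W patchE; case: ifPn => [|_]; last by rewrite normr0.
  by rewrite inE/= in_itv/=; exact: WM'.
have HM x : `|H x| <= M.
  rewrite /H patchE; case: ifPn => [|_]; last by rewrite normr0.
  by rewrite inE/= in_itv/=; exact: HM'.
have Wneg s : s < 0 -> W s = 0.
  move=> s0; rewrite /W patchE ifF//; apply/negbTE/negP.
  by rewrite inE/= in_itv/= leNgt s0.
have Hneg s : s < 0 -> H s = 0.
  move=> s0; rewrite /H patchE ifF//; apply/negbTE/negP.
  by rewrite inE/= in_itv/= ltNge (ltW s0).
have [tWp tWm] := tame_parts mW WM Wneg.
have [tHp tHm] := tame_parts mH HM Hneg.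
have a0 : 0 < 1 - gamma by rewrite subr_gt0.
have h1 : forall b c n, 0 < b -> b < c -> c < T ->
   fine (\int[mu]_r ((bumpf b c n r)%:E * rlint (1 - gamma)%R W^\+%R r)) -
   fine (\int[mu]_r ((bumpf b c n r)%:E * rlint (1 - gamma)%R W^\-%R r)) =
   fine (\int[mu]_r ((bumpf b c n r)%:E * rlint 1%R H^\+%R r)) -
   fine (\int[mu]_r ((bumpf b c n r)%:E * rlint 1%R H^\-%R r)).
  move=> b c n b0 bc cT.
  have bout x : x \notin `]b, c[ -> bumpf b c n x = 0
    by exact: bump_out (ltW bc).
  have mb := measurable_bump b c n.
  have eW := pairing a0 b0 bc cT mb (bump_ge0 b c n) (bump_le1 b c n) bout mW
    WM Wneg.
  have eH := pairing ltr01 b0 bc cT mb (bump_ge0 b c n) (bump_le1 b c n) bout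
    mH HM Hneg.
  exact: etrans (esym eW)
    (etrans (strong_solution_weak n g0 g1 b0 bc cT mH sol) eH).
have := abel_inversion g0 g1 T0 tWp tWm tHp tHm
  (ae_eq_of_pairing g1 T0 tWp tWm tHp tHm h1).
apply: filterS; first exact: (ae_filter_ringOfSetsType mu).
move=> x /= ex x0T; have {ex} := ex x0T.
rewrite -(fineK (rlint_fin_num x g0 tHp)) -(fineK (rlint_fin_num x g0 tHm)) /=.
rewrite -!EFinD => -[] e.
have {e} -> : fine (rlint gamma H^\+ x) - fine (rlint gamma H^\- x) =
    fine (beta gamma (1 - gamma)) * (W^\+ x - W^\- x).
  rewrite mulrBr; lra.
have -> : W^\+ x - W^\- x = W x by rewrite -[in RHS](funrposBneg W).
rewrite /volterra_const -mulrA /W patchE mem_set//= in_itv/=.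
by case/andP: x0T => x0 ->; rewrite ltW.
Qed.
End WeakForm.

(** * Comparison for Volterra equations *)

Section Comparison.
Variable R : realType.
Local Notation mu := (@lebesgue_measure R).
Implicit Types (a b c d s t x T M L : R).

(** Intervals have positive measure; through this, the almost everywhere
equations are combined with continuity. *)
Lemma ae_itv_ex a b (P : R -> Prop) : a < b -> {ae mu, forall x, P x} ->
  exists2 x, a < x < b & P x.
Proof.
move=> ab [N [mN N0 PN]]; apply: contrapT => nP.
have sub : `]a, b[%classic `<=` N.
  move=> x; rewrite /= in_itv/= => xab; apply: PN => /= Px.
  by apply: nP; exists x.
have : (mu `]a, b[%classic <= 0)%E.
  rewrite -N0; apply: le_measure => //; rewrite inE//; exact: measurable_itv.
by rewrite lebesgue_measure_itv/= lte_fin ab -EFinB lee_fin leNgt subr_gt0 ab.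
Qed.

Lemma within_itv_near a b (w : R -> R) c e : {within `[a, b], continuous w} ->
  a <= c <= b -> 0 < e ->
  exists2 d, 0 < d & forall s, a <= s <= b -> `|c - s| < d -> `|w c - w s| < e.
Proof.
move=> /subspace_continuousP cw cab e0.
have /(cw c) : `[a, b]%classic c by rewrite /= in_itv.
move=> /cvgrPdist_lt /(_ e e0) [d /= d0 dP]; exists d => // s sab cs.
by apply: dP => //=; rewrite in_itv.
Qed.

Lemma rlint_small (gamma L K : R) : 0 < gamma -> 0 <= L -> 0 < K ->
  \forall d \near 0^'+, L * (d `^ gamma / gamma) <= K.
Proof.
move=> g0 L0 K0.
have h : L * (d `^ gamma / gamma) @[d --> 0^'+] --> (L * (0 / gamma) : R).
  by apply: cvgMl_tmp; apply: cvgMr_tmp; exact: powR_cvg0.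
rewrite mul0r mulr0 in h.
by move/cvgr_le : h; apply.
Qed.

Section volterra.
Variables (gamma T K M : R) (u1 u2 H1 H2 : R -> R).
Hypotheses (g0 : 0 < gamma) (K0 : 0 < K)
  (mH1 : measurable_fun [set: R] H1) (mH2 : measurable_fun [set: R] H2)
  (H1M : forall x, `|H1 x| <= M) (H2M : forall x, `|H2 x| <= M)
  (H1neg : forall s, s < 0 -> H1 s = 0) (H2neg : forall s, s < 0 -> H2 s = 0).

(** One step of the comparison.  Up to the sign of the initial values, the
difference of the two Volterra equations is the fractional integral of H2 - H1,
and it is at most that of the positive part of H2 - H1, which vanishes before
time a and is at most L m after it. *)
Lemma volterra_diff_le a d L (m : R) x : 0 <= a -> a < x < a + d ->
  u2 0 <= u1 0 -> 0 <= L -> 0 <= m ->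
  K * (u1 x - u1 0) =
  fine (rlint gamma H1^\+ x) - fine (rlint gamma H1^\- x) ->
  K * (u2 x - u2 0) =
  fine (rlint gamma H2^\+ x) - fine (rlint gamma H2^\- x) ->
  (forall s, s < a -> H2 s <= H1 s) ->
  (forall s, a <= s < a + d -> H2 s - H1 s <= L * m) ->
  K * (u2 x - u1 x) <= m * (L * (d `^ gamma / gamma)).
Proof.
move=> a0 /andP[ax xd] u0 L0 m0 e1 e2 Hle HL.
have [t1p t1m] := tame_parts mH1 H1M H1neg.
have [t2p t2m] := tame_parts mH2 H2M H2neg.
(* H2^+ + H1^- <= H1^+ + H2^- + E, where all terms are nonnegative. *)
pose E s := Num.max (H2 s - H1 s) 0.
have mE : measurable_fun [set: R] E.
  by apply: measurable_maxr => //; exact: measurable_funB.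
have E0 s : 0 <= E s by rewrite /E le_max lexx orbT.
have Ea s : s < a -> E s = 0.
  by move=> sa; apply/max_idPr; rewrite subr_le0 Hle.
have Ex s : s < x -> E s <= L * m.
  move=> sx; have [sa|as_] := ltP s a; first by rewrite Ea// mulr_ge0.
  by rewrite /E ge_max mulr_ge0// HL// as_ (lt_trans sx).
have Eint := rlint_le g0 ax (mulr_ge0 L0 m0) mE E0 Ea Ex.
have add (V W : R -> R) : (forall s, 0 <= V s) -> (forall s, 0 <= W s) ->
    measurable_fun [set: R] V -> measurable_fun [set: R] W ->
    (rlint gamma (fun s => V s + W s)%R x =
     rlint gamma V x + rlint gamma W x)%E.
  move=> V0 W0 mV mW; rewrite /rlint.
  have mVE : measurable_fun [set: R] (EFin \o V) by exact/measurable_EFinP.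
  have mWE : measurable_fun [set: R] (EFin \o W) by exact/measurable_EFinP.
  have VE0 y : (0 <= (EFin \o V) y)%E by rewrite lee_fin.
  have WE0 y : (0 <= (EFin \o W) y)%E by rewrite lee_fin.
  have k0 y : (0 <= (EFin \o rlker gamma) y)%E by rewrite lee_fin rlker_ge0.
  by rewrite -(convolDr (measurable_rlkerE gamma) mVE mWE k0 VE0 WE0).
have [m1p p1p _ _] := t1p; have [m1m p1m _ _] := t1m.
have [m2p p2p _ _] := t2p; have [m2m p2m _ _] := t2m.
have key : (rlint gamma H2^\+%R x + rlint gamma H1^\-%R x <=
    rlint gamma H1^\+%R x + rlint gamma H2^\-%R x + rlint gamma E x)%E.
  rewrite -(add _ _ p2p p1m m2p m1m) -(add _ _ p1p p2m m1p m2m).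
  have p12 s : 0 <= H1^\+ s + H2^\- s by rewrite addr_ge0.
  have m12 : measurable_fun [set: R] (fun s => H1^\+ s + H2^\- s).
    exact: measurable_funD.
  rewrite -(add _ _ p12 E0 m12 mE).
  apply: ge0_le_integral => //.
  - by move=> s _; rewrite -EFinM lee_fin mulr_ge0 ?rlker_ge0// addr_ge0.
  - apply: emeasurable_funM; first exact: measurable_rlkerB.
    by apply/measurable_EFinP; exact: measurable_funD.
  - apply: emeasurable_funM; first exact: measurable_rlkerB.
    by apply/measurable_EFinP; apply: measurable_funD.
  move=> s _ /=; rewrite lee_fin ler_wpM2l ?rlker_ge0//.
  have := congr1 (fun g => g s) (funrposBneg H1).
  have := congr1 (fun g => g s) (funrposBneg H2).
  have : H2 s - H1 s <= E s by rewrite /E le_max lexx.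
  rewrite !fctE; lra.
have Efin : rlint gamma E x \is a fin_num.
  by rewrite ge0_fin_numE ?rlint_ge0// (le_lt_trans Eint)// ltry.
have E1 : fine (rlint gamma E x) <= L * m * (d `^ gamma / gamma).
  rewrite -lee_fin fineK//; apply: (le_trans Eint).
  rewrite lee_fin ler_wpM2l ?mulr_ge0// ler_pM2r ?invr_gt0//.
  by rewrite ge0_ler_powR ?nnegrE ?(ltW g0)//; lra.
move: key; rewrite -(fineK (rlint_fin_num x g0 t1p))
  -(fineK (rlint_fin_num x g0 t1m)).
rewrite -(fineK (rlint_fin_num x g0 t2p)) -(fineK (rlint_fin_num x g0 t2m)).
rewrite -(fineK Efin) -!EFinD lee_fin => key.
have hK : K * (u2 x - u1 x) =
    K * (u2 0 - u1 0) + K * (u2 x - u2 0) - K * (u1 x - u1 0).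
  ring.
have hu : K * (u2 0 - u1 0) <= 0 by rewrite mulr_ge0_le0 ?subr_le0// ltW.
have hm : m * (L * (d `^ gamma / gamma)) = L * m * (d `^ gamma / gamma) by ring.
lra.
Qed.

(** At the infimum [a] of the times where u1 < u2 both functions agree.  On a
short interval after [a], [volterra_diff_le] bounds u2 - u1 by half of its
maximum. *)
Lemma volterra_comparison :
  {within `[0, T], continuous u1} -> {within `[0, T], continuous u2} ->
  u2 0 <= u1 0 ->
  {ae mu, forall x, 0 < x < T ->
    K * (u1 x - u1 0) =
    fine (rlint gamma H1^\+ x) - fine (rlint gamma H1^\- x)} ->
  {ae mu, forall x, 0 < x < T ->
    K * (u2 x - u2 0) =
    fine (rlint gamma H2^\+ x) - fine (rlint gamma H2^\- x)} ->
  (forall s, s < T -> u2 s <= u1 s -> H2 s <= H1 s) ->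
  (forall a, 0 <= a < T -> u1 a = u2 a -> exists2 d, 0 < d & exists2 L, 0 <= L &
    forall s, a <= s < a + d -> s < T ->
      H2 s - H1 s <= L * Num.max (u2 s - u1 s) 0) ->
  forall t, 0 <= t < T -> u2 t <= u1 t.
Proof.
move=> c1 c2 u0 v1 v2 Hmono Hlip t /andP[t0 tT].
have cw : {within `[0, T], continuous (fun s => u2 s - u1 s)}.
  by move=> s; apply: continuousB; [exact: c2|exact: c1].
pose S := [set s | (0 <= s < T) /\ u1 s < u2 s].
rewrite leNgt; apply/negP => ut.
have St : S t by split => //; rewrite t0.
have lbS : lbound S 0 by move=> s [/andP[]].
have hiS : has_inf S by split; [exists t|exists 0].
pose a := inf S.
have a0 : 0 <= a by apply: lb_le_inf; [exists t|].
have aT : a < T by apply: le_lt_trans tT; apply: ge_inf => //; exists 0.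
have below s : 0 <= s -> s < a -> u2 s <= u1 s.
  move=> s0 sa; rewrite leNgt; apply/negP => us.
  have : a <= s by apply: ge_inf; [exists 0|split => //;
    rewrite s0 (lt_trans sa)].
  by rewrite leNgt sa.
have above e : 0 < e -> exists2 s, S s & s < a + e.
  by move=> e0; exact: inf_adherent.
have a0T : 0 <= a <= T by rewrite a0 ltW.
(* If w a < 0, then w < 0 also shortly before a; if w a > 0, then w > 0 shortly
   after a.  Both contradict the definition of a. *)
have wa : u1 a = u2 a.
  have [wlt|wgt|//] := ltgtP (u1 a) (u2 a).
    have wa0 : 0 < u2 a - u1 a by rewrite subr_gt0.
    have [d d0 hd] := within_itv_near cw a0T wa0.
    have a_gt0 : 0 < a.
      by rewrite lt_neqAle a0 andbT; apply/eqP => a00; move: wlt;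
        rewrite -a00 ltNge u0.
    pose s := Num.max (a - d / 2) 0.
    have sa : s < a by rewrite gt_max a_gt0 andbT; lra.
    have s0 : 0 <= s by rewrite le_max lexx orbT.
    have sd : a - d / 2 <= s by rewrite le_max lexx.
    have := hd s; rewrite s0 (ltW (lt_trans sa aT)) => /(_ isT).
    rewrite ger0_norm ?subr_ge0 ?(ltW sa)// => /(_ _)/wrap[]; first lra.
    by have := below s s0 sa => us /ltr_normlW; lra.
  have wa0 : 0 < u1 a - u2 a by rewrite subr_gt0.
  have [d d0 hd] := within_itv_near cw a0T wa0.
  have [s Ss sad] := above d d0.
  have as_ : a <= s by apply: ge_inf => //; exists 0.
  have [/andP[s0 sT] us] := Ss.
  have := hd s; rewrite s0 (ltW sT) => /(_ isT).
  rewrite ler0_norm ?subr_le0// => /(_ _)/wrap[]; first lra.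
  by rewrite ltr_norml => /andP[]; lra.
have [d0 d0_gt0 [L L0 HL]] := Hlip a (introT andP (conj a0 aT)) wa.
have [d [d_gt0 dd0 adT Ld]] : exists d, [/\ 0 < d, d <= d0, a + d <= T &
    L * (d `^ gamma / gamma) <= K / 2].
  have K2 : 0 < K / 2 by rewrite divr_gt0.
  have : \forall d \near 0^'+, [/\ 0 < d, d <= d0, a + d <= T &
    L * (d `^ gamma / gamma) <= K / 2].
    near=> d; split.
    - near: d; exact: nbhs_right_gt.
    - near: d; exact: nbhs_right_le.
    - by rewrite addrC -lerBrDr; near: d; apply: nbhs_right_le;
      rewrite subr_gt0.
    - near: d; exact: rlint_small.
  by move=> /filter_ex.
have ad : a < a + d by rewrite ltrDl.
have sub : `[a, a + d] `<=` `[0, T].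
  by move=> s; rewrite /= !in_itv/= => /andP[? ?]; apply/andP; split; lra.
have cwa := continuous_subspaceW sub cw.
have [c cad cmax] := EVT_max (ltW ad) cwa.
have {}cmax s : a <= s <= a + d -> u2 s - u1 s <= u2 c - u1 c.
  by move=> sad; apply: cmax; rewrite in_itv.
have {}cad : a <= c <= a + d by rewrite in_itv in cad.
set m := u2 c - u1 c in cmax.
have m_gt0 : 0 < m.
  have [s Ss sad] := above d d_gt0.
  have as_ : a <= s by apply: ge_inf => //; exists 0.
  have [_ us] := Ss.
  have := cmax s; rewrite as_ (ltW sad) => /(_ isT); lra.
have half : {ae mu, forall x, a < x < a + d -> u2 x - u1 x <= m / 2}.
  have : {ae mu, forall x, 0 < x < T ->
     K * (u1 x - u1 0) =
     fine (rlint gamma H1^\+ x) - fine (rlint gamma H1^\- x) /\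
     K * (u2 x - u2 0) =
     fine (rlint gamma H2^\+ x) - fine (rlint gamma H2^\- x)}.
    move: v1 v2; apply: filterS2; first exact: (ae_filter_ringOfSetsType mu).
    by move=> x /= e1 e2 xT; split; [exact: e1|exact: e2].
  apply: filterS; first exact: (ae_filter_ringOfSetsType mu).
  move=> x /= ex axd; have xT : 0 < x < T by move/andP: axd => [? ?];
    apply/andP; split; lra.
  have [e1 e2] := ex xT.
  have Hle s : s < a -> H2 s <= H1 s.
    move=> sa; have [s0|s0] := ltP s 0; first by rewrite H1neg// H2neg.
    by apply: Hmono; [exact: lt_trans aT|exact: below].
  have HLm s : a <= s < a + d -> H2 s - H1 s <= L * m.
    move=> /andP[as_ sad]; apply: (le_trans (HL s _ _)).
    - by rewrite as_/=; lra.
    - by apply: lt_le_trans adT.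
    rewrite ler_wpM2l// ge_max (ltW m_gt0) andbT cmax// as_/= ltW//.
  have := volterra_diff_le a0 axd u0 L0 (ltW m_gt0) e1 e2 Hle HLm.
  move=> h; rewrite -(ler_pM2l K0); apply: (le_trans h).
  by rewrite [leRHS]mulrCA ler_wpM2l ?(ltW m_gt0).
(* Near the point c where u2 - u1 equals m, it exceeds m - m / 4 > m / 2. *)
have m4 : 0 < m / 4 by rewrite divr_gt0.
have [r r0 hr] := within_itv_near cwa cad m4.
have [p [q [pq pqad pqc]]] : exists p q, [/\ p < q, a <= p /\ q <= a + d &
    forall x, p < x < q -> `|c - x| < r].
  exists (Num.max a (c - r)), (Num.min (a + d) (c + r)); split.
  - by move/andP: cad => [? ?]; rewrite gt_max !lt_min; apply/andP; split;
    apply/andP; split; lra.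
  - by rewrite le_max lexx ge_min lexx.
  - move=> x; rewrite gt_max lt_min => /andP[/andP[_ xl] /andP[_ xr]].
    by rewrite ltr_norml; apply/andP; split; lra.
have [x xpq hx] := ae_itv_ex pq half.
move: pqad xpq => [ap qad] xpq.
have xad : a < x < a + d by move/andP: (xpq) => [? ?]; apply/andP; split; lra.
have := hr x; have -> : a <= x <= a + d by move/andP: xad => [? ?]; apply/andP;
  split; lra.
move=> /(_ isT (pqc x xpq)); rewrite -/m ltr_norml => /andP[_].
have := hx xad; lra.
Unshelve. all: by end_near. Qed.

End volterra.
End Comparison.

(** * Comparison of solutions *)

Section Solutions.
Variable R : realType.
Local Notation mu := (@lebesgue_measure R).
Implicit Types (t s x y z T M L : R) (f g u : R -> R) (alpha beta Tb : \bar R).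

Lemma locally_lipschitz_ball f (I : set R) x : locally_lipschitz f I -> I x ->
  exists2 L, 0 <= L & exists2 e, 0 < e & forall y z, `|x - y| < e ->
    `|x - z| < e -> I y -> I z -> `|f y - f z| <= L * `|y - z|.
Proof.
move=> lf Ix; have [U [e /= e0 eU] lU] := lf x Ix.
have : \forall L \near +oo, 0 <= L /\ L.-lipschitz_(U `&` I) f.
  near=> L; split; near: L; first exact: nbhs_pinfty_ge.
  exact: lU.
move=> /filter_ex [L [L0 hL]]; exists L => //; exists e => // y z xy xz Iy Iz.
by apply: (hL (y, z)); split => /=; split => //; exact: eU.
Unshelve. all: by end_near. Qed.

Lemma within_itv_comp f (I : set R) u T : locally_lipschitz f I ->
  {within `[0, T], continuous u} -> (forall t, 0 <= t <= T -> I (u t)) ->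
  {within `[0, T], continuous (f \o u)}.
Proof.
move=> lf cu Iu; apply/subspace_continuousP => t tT.
have {}tT : 0 <= t <= T by move: tT; rewrite /= in_itv.
apply/cvgrPdist_lt => e e0.
have [L L0 [r r0 hL]] := locally_lipschitz_ball lf (Iu t tT).
have re0 : 0 < Num.min r (e / (L + 1)) by rewrite lt_min r0 divr_gt0// ltr_wpDl.
have [d d0 hd] := within_itv_near cu tT re0.
exists d => //= s ts; rewrite in_itv/= => sT.
have := hd s sT ts; rewrite lt_min => /andP[sr se].
apply: (le_lt_trans (hL _ _ _ sr _ _)); rewrite ?subrr ?normr0//; try exact: Iu.
move: se; rewrite ltr_pdivlMr ?ltr_wpDl//; apply: le_lt_trans.
by rewrite mulrC ler_wpM2l// lerDl.
Qed.

Lemma within_itv_bounded g T : 0 < T -> {within `[0, T], continuous g} ->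
  exists M, forall t, 0 <= t <= T -> `|g t| <= M.
Proof.
move=> T0 cg.
have cn : {within `[0, T], continuous (fun t => `|g t|)}.
  by move=> x; apply: continuous_comp; [exact: cg|exact: norm_continuous].
have [c _ cmax] := EVT_max (ltW T0) cn.
by exists `|g c| => t tT; apply: cmax; rewrite in_itv.
Qed.

Lemma measurable_within_itv g T (D : set (measurableTypeR R)) :
  {within `[0, T], continuous g} -> measurable D -> D `<=` `[0, T] ->
  measurable_fun [set: R] (g \_ D).
Proof.
move=> cg mD DT; apply/(measurable_restrictT _ _).1 => //.
apply: (@measurable_funS _ _ _ _ `[0, T]%classic) => //.
exact: subspace_continuous_measurable_fun.
Qed.

(** A continuous strong solution is bounded and measurable on each [0, T] below
its existence time, and so is its image under [f]; this is all that the Volterra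
equation asks for. *)
Lemma solution_volterra gamma f alpha beta Tb u T :
  0 < gamma -> gamma < 1 -> locally_lipschitz f (open_interval alpha beta) ->
  continuous_strong_solution gamma f alpha beta Tb u ->
  0 < T -> (T%:E < Tb)%E ->
  [/\ {within `[0, T], continuous u},
      (forall t, 0 <= t <= T -> open_interval alpha beta (u t)),
      measurable_fun [set: R] ((f \o u) \_ `]0, T[),
      exists M, forall x, `|((f \o u) \_ `]0, T[) x| <= M &
      {ae mu, forall x, 0 < x < T ->
        volterra_const gamma * (u x - u 0) =
        fine (rlint gamma ((f \o u) \_ `]0%R, T[)^\+ x) -
        fine (rlint gamma ((f \o u) \_ `]0%R, T[)^\- x)}].
Proof.
move=> g0 g1 lf [_ cu Iu sol] T0 TTb.
have sub : `[0, T] `<=` half_open Tb.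
  move=> t; rewrite /= in_itv/= => /andP[t0 tT]; split => //.
  by apply: le_lt_trans TTb; rewrite lee_fin.
have {}cu := continuous_subspaceW sub cu.
have {}Iu t : 0 <= t <= T -> open_interval alpha beta (u t).
  by move=> tT; apply/Iu/sub; rewrite /= in_itv.
have cfu := within_itv_comp lf cu Iu.
have cw : {within `[0, T], continuous
    (fun t => (Gamma (1 - gamma))^-1 * (u t - u 0))}.
  by move=> x; apply: cvgMl_tmp; apply: cvgB; [exact: cu|exact: cvg_cst].
have [M1 hM1] := within_itv_bounded T0 cfu.
have [M2 hM2] := within_itv_bounded T0 cw.
have mH : measurable_fun [set: R] ((f \o u) \_ `]0, T[).
  by apply: measurable_within_itv cfu _ _ => //; exact: subset_itv_oo_cc.
have mW : measurable_fun [set: R]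
  ((fun t => (Gamma (1 - gamma))^-1 * (u t - u 0)) \_ `[0, T[).
  by apply: measurable_within_itv cw _ _ => //; exact: subset_itv_co_cc.
have M1_ge0 : 0 <= M1 by apply: le_trans (hM1 0 _); rewrite ?lexx ?normr_ge0
  ?(ltW T0).
split => //.
  exists M1 => x; rewrite patchE; case: ifPn => [|_]; last by rewrite normr0.
  by rewrite inE/= in_itv/= => /andP[x0 xT]; apply: hM1; rewrite !ltW.
apply: (@strong_solution_volterra _ _ _ _ _ (Num.max M1 M2)) => //.
- move=> t /andP[t0 tT]; rewrite le_max (hM2 t) ?orbT//; by rewrite t0 ltW.
- by move=> t /andP[t0 tT]; rewrite le_max [X in X || _](hM1 t)// !ltW.
- exact: sol.
Qed.
End Solutions.

Theorem corollary4p3 (R : realType) (gamma : R) (alpha beta : \bar R)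
    (f1 f2 u1 u2 : R -> R) (Tb1 Tb2 : \bar R)
    (gamma_gt0 : 0 < gamma) (gamma_lt1 : gamma < 1)
    (f1_lip : locally_lipschitz f1 (open_interval alpha beta))
    (f2_lip : locally_lipschitz f2 (open_interval alpha beta))
    (f2_le_f1 : forall x, open_interval alpha beta x -> f2 x <= f1 x)
    (f_mono : nondecreasing_on f1 (open_interval alpha beta) \/
              nondecreasing_on f2 (open_interval alpha beta))
    (u1_sol : maximal_solution gamma f1 alpha beta Tb1 u1)
    (u2_sol : maximal_solution gamma f2 alpha beta Tb2 u2)
    (alpha_lt : (alpha < (u2 0)%:E)%E) (u20_le_u10 : u2 0 <= u1 0)
    (lt_beta : ((u1 0)%:E < beta)%E) :
  forall t : R, 0 < t -> (t%:E < Order.min Tb1 Tb2)%E -> u2 t <= u1 t.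
Proof.
move=> t t0 tTb.
set I := open_interval alpha beta in f1_lip f2_lip f2_le_f1 f_mono.
have [T tT TTb] : exists2 T : R, t < T & (T%:E < Order.min Tb1 Tb2)%E.
  move: tTb; case: (Order.min Tb1 Tb2) => [r| |]//.
    rewrite lte_fin => tr; exists ((t + r) / 2); rewrite ?lte_fin; lra.
  by move=> _; exists (t + 1); rewrite ?ltry// ltrDl.
have T0 : 0 < T by exact: lt_trans tT.
move: TTb; rewrite lt_min => /andP[TTb1 TTb2].
have [c1 I1 m1 [M1 hM1] v1] :=
  solution_volterra gamma_gt0 gamma_lt1 f1_lip u1_sol.1 T0 TTb1.
have [c2 I2 m2 [M2 hM2] v2] :=
  solution_volterra gamma_gt0 gamma_lt1 f2_lip u2_sol.1 T0 TTb2.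
have [f [f_lip f_nd f21]] : exists f, [/\ locally_lipschitz f I,
  nondecreasing_on f I &
    forall y z, I y -> I z -> f2 y - f1 z <= f y - f z].
  case: f_mono => nd; [exists f1|exists f2]; split => // y z Iy Iz.
    by rewrite lerD2r f2_le_f1.
  by rewrite lerD2l lerN2 f2_le_f1.
have bound (g : R -> R) (m n : R) : (forall x, `|g x| <= m) ->
    forall x, `|g x| <= Num.max m n.
  by move=> gm x; rewrite le_max gm.
have hM2' x : `|((f2 \o u2) \_ `]0, T[) x| <= Num.max M1 M2 by rewrite maxC;
  exact: bound.
have neg (g : R -> R) s : s < 0 -> (g \_ `]0, T[) s = 0.
  move=> s0; rewrite patchE ifF//; apply/negbTE/negP.
  by rewrite inE/= in_itv/= ltNge (ltW s0).
have := volterra_comparison gamma_gt0 (volterra_const_gt0 gamma_gt0 gamma_lt1)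
  m1 m2 (bound _ _ M2 hM1) hM2' (neg (f1 \o u1)) (neg (f2 \o u2)) c1 c2
    u20_le_u10 v1 v2.
apply; last first.
- by rewrite ltW.
- move=> a /andP[a0 aT] ua.
  have aT' : 0 <= a <= T by rewrite a0 ltW.
  have [L L0 [e e0 hL]] := locally_lipschitz_ball f_lip (I1 a aT').
  have [d1 d1_gt0 hd1] := within_itv_near c1 aT' e0.
  have [d2 d2_gt0 hd2] := within_itv_near c2 aT' e0.
  exists (Num.min d1 d2); first by rewrite lt_min d1_gt0.
  exists L => // s /andP[as_ sad] sT.
  have s0 : 0 <= s by exact: le_trans as_.
  have sT' : 0 <= s <= T by rewrite s0 ltW.
  have asd : `|a - s| < Num.min d1 d2.
    by rewrite distrC ger0_norm ?subr_ge0// ltrBlDl.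
  move: asd; rewrite lt_min => /andP[asd1 asd2].
  rewrite !patchE; case: ifPn => _; last by rewrite subrr mulr_ge0// le_max
    lexx orbT.
  apply: (le_trans (f21 _ _ (I2 s sT') (I1 s sT'))).
  have [us|us] := leP (u2 s) (u1 s).
    apply: (@le_trans _ _ 0); first by rewrite subr_le0 f_nd//;
      [exact: I2|exact: I1].
    by rewrite mulr_ge0// le_max lexx orbT.
  apply: (le_trans (ler_norm _)).
  apply: (le_trans (hL _ _ _ _ (I2 s sT') (I1 s sT'))).
  - by rewrite ua; exact: hd2.
  - exact: hd1.
  by rewrite ler_wpM2l// ger0_norm ?subr_ge0 ?(ltW us)// le_max lexx.
- move=> s sT us; rewrite !patchE; case: ifPn => //.
  rewrite inE/= in_itv/= => /andP[s0 _].
  have sT' : 0 <= s <= T by rewrite !ltW.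
  rewrite -subr_le0; apply: (le_trans (f21 _ _ (I2 s sT') (I1 s sT'))).
  by rewrite subr_le0 f_nd//; [exact: I2|exact: I1].
Qed.
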